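(* Suppose $(X,\mu,T)$ is a finite measure-preserving ergodic dynamical system. Then $T$ is Li-Yorke M-sensitive if and only if it is weakly mixing.
   Context: Here $X$ is a standard Borel space with a finite nonatomic (nonzero) measure $\mu$, and $T:X\to X$ is measurable (not necessarily invertible) with $\mu(T^{-1}A)=\mu(A)$ for all measurable $A$. $T$ is ergodic if $T^{-1}(A)=A$ implies $\mu(A)=0$ or $\mu(X\setminus A)=0$. $T$ is weakly mixing if whenever $f\in L^\infty$ satisfies $f\circ T=zf$ a.e. for some $z\in\mathbb{C}$, then $f$ is constant a.e. All metrics $d$ on $X$ are assumed Borel measurable on $X\times X$ and bounded by $1$. A metric $d$ is $\mu$-compatible if every nonempty open $d$-ball has positive $\mu$-measure. A pair $(x,y)$ is a Li-Yorke pair for $d$ if $\liminf_{n\to\infty}d(T^nx,T^ny)=0$ and $\limsup_{n\to\infty}d(T^nx,T^ny)>0$. $T$ is Li-Yorke M-sensitive if for every $\mu$-compatible metric $d$ on $X$ the set of Li-Yorke pairs has full $\mu\times\mu$-measure in $X\times X$. *)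

(* Defs.v *)
From HB Require Import structures.
From mathcomp Require Import all_boot all_order all_algebra.
From mathcomp Require Import all_classical all_reals all_analysis.
From mathcomp Require Import ess_sup_inf complex.

Set Implicit Arguments.
Unset Strict Implicit.
Unset Printing Implicit Defensive.

Import Order.TTheory GRing.Theory Num.Theory.
Import numFieldNormedType.Exports.

Local Open Scope classical_set_scope.
Local Open Scope ring_scope.
Local Open Scope ereal_scope.

(* A Hausdorff pseudometric space is metric, so [P] is a Polish space. [f]
   identifies the sigma-algebra of [X] with the Borel sigma-algebra of [P]. *)
Definition standard_borel (R : realType) (dX : measure_display)
    (X : measurableType dX) : Prop :=
  exists (P : completePseudoMetricType R) (f : X -> P),
    [/\ hausdorff_space P,
        @second_countable P,
        bijective f &
        @measurable dX X = preimage_set_system setT f <<s @open P >>].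

Definition nonatomic (R : realType) (dX : measure_display)
    (X : measurableType dX) (mu : {measure set X -> \bar R}) : Prop :=
  forall A : set X, measurable A -> 0 < mu A ->
    exists B : set X, [/\ measurable B, B `<=` A, 0 < mu B & mu B < mu A].

Definition measure_preserving (R : realType) (dX : measure_display)
    (X : measurableType dX) (mu : {measure set X -> \bar R}) (T : X -> X) :
    Prop :=
  measurable_fun setT T /\
  forall A : set X, measurable A -> mu (T @^-1` A) = mu A.

Definition ergodic (R : realType) (dX : measure_display)
    (X : measurableType dX) (mu : {measure set X -> \bar R}) (T : X -> X) :
    Prop :=
  forall A : set X, measurable A -> T @^-1` A = A ->
    mu A = 0 \/ mu (~` A) = 0.

Definition complex_Linfty (R : realType) (dX : measure_display)
    (X : measurableType dX) (mu : {measure set X -> \bar R})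
    (f : X -> R[i]) : Prop :=
  [/\ measurable_fun setT (fun x => complex.Re (f x)),
      measurable_fun setT (fun x => complex.Im (f x)) &
      ess_sup mu (fun x => (Normc.normc (f x))%:E) < +oo].

Definition weakly_mixing (R : realType) (dX : measure_display)
    (X : measurableType dX) (mu : {measure set X -> \bar R}) (T : X -> X) :
    Prop :=
  forall (f : X -> R[i]) (z : R[i]), complex_Linfty mu f ->
    {ae mu, forall x, f (T x) = (z * f x)%R} ->
    exists c : R[i], {ae mu, forall x, f x = c}.

Record borel_metric (R : realType) (dX : measure_display)
    (X : measurableType dX) (d : X -> X -> R) : Prop := BorelMetric {
  bmetric_ge0 : forall x y, (0 <= d x y)%R ;
  bmetric_le1 : forall x y, (d x y <= 1)%R ;
  bmetric_eq0 : forall x y, d x y = 0%R <-> x = y ;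
  bmetric_sym : forall x y, d x y = d y x ;
  bmetric_triangle : forall x y z, (d x z <= d x y + d y z)%R ;
  bmetric_measurable : measurable_fun [set: X * X] (fun p => d p.1 p.2)
}.

Definition dball (R : realType) (X : Type) (d : X -> X -> R) (x : X) (r : R) :
  set X := [set y | (d x y < r)%R].

Definition compatible_metric (R : realType) (dX : measure_display)
    (X : measurableType dX) (mu : {measure set X -> \bar R})
    (d : X -> X -> R) : Prop :=
  borel_metric d /\
  forall (x : X) (r : R), dball d x r !=set0 -> 0 < mu (dball d x r).

Definition li_yorke_pair (R : realType) (X : Type) (T : X -> X)
    (d : X -> X -> R) (x y : X) : Prop :=
  limn_einf (fun n => (d (iter n T x) (iter n T y))%:E) = 0 /\
  0 < limn_esup (fun n => (d (iter n T x) (iter n T y))%:E).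

Definition li_yorke_M_sensitive (R : realType) (dX : measure_display)
    (X : measurableType dX) (mu : {finite_measure set X -> \bar R})
    (T : X -> X) : Prop :=
  forall d : X -> X -> R, compatible_metric mu d ->
    {ae (mu \x mu), forall p, li_yorke_pair T d p.1 p.2}.

(* Main.v *)
Require Import Defs.
From HB Require Import structures.
From mathcomp Require Import all_boot all_order all_algebra.
From mathcomp Require Import all_classical all_reals all_analysis.
From mathcomp Require Import measurable_realfun ess_sup_inf complex.
From mathcomp Require Import zify ring lra.

(* From weak mixing to Li-Yorke pairs.  It suffices that T x T is ergodic: almost
   every orbit of T x T then visits infinitely often each set {d < e}, which is
   non-null because balls are, and some non-null set {d > e}.  If a T x T-invariant
   set E were neither null nor conull, K = 1_E - c (c the mean of 1_E) would be a
   nonzero invariant kernel, with null row means by ergodicity of T.  Put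
   M = K K^*.  Kernel powers of M, suitably normalised, converge to the projection
   onto the top eigenspace of M^2.  That eigenspace is nonzero, finite-dimensional
   by Bessel's inequality and stable under f |-> f o T, so it contains a complex
   eigenfunction of T; it has mean zero, contradicting weak mixing.

   From sensitivity to weak mixing.  Let f o T = z f.  If |z| < 1 then f = 0 a.e.
   If |z| >= 1, it is enough to find a compatible metric d with
   d(x,y) >= min(1, |f x - f y|) off a null set: d stays bounded below along the
   orbit of (x,y) as soon as f x <> f y, so f x = f y for almost every pair and f is
   a.e. constant.  Take |phi x - phi y| + |f x - f y| with phi an injective Borel
   code.  Only the points of a null set N have null balls; they are moved so as to
   become limits of non-null sets D_k on which f tends to a fixed value f x0, with
   every D_k shrunk by a factor 1/k and placed near a point c_k of a dense
   sequence. *)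

Set Implicit Arguments.
Unset Strict Implicit.
Unset Printing Implicit Defensive.

Import Order.TTheory GRing.Theory Num.Theory.
Import numFieldNormedType.Exports.

Local Open Scope classical_set_scope.
Local Open Scope ring_scope.

(** * Bounded measurable functions *)

(** A discriminant bound without division: [(s, t) = (c, b)] gives [c * (a * c - b ^+ 2) >= 0],
    which settles [c > 0], and [(b, a + 1)] forces [b = 0] when [c = 0]. *)
Lemma sqr_le_of_quad_ge0 (R : realDomainType) (a b c : R) :
  (forall s t, 0 <= s ^+ 2 * a - 2 * s * t * b + t ^+ 2 * c) -> b ^+ 2 <= a * c.
Proof.
move=> h; have := h 1 0; have := h 0 1; have := h c b; have := h b (a + 1).
rewrite !expr2 !(mul1r, mul0r, mulr0, mulr1, subr0, addr0, add0r, oppr0).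
move=> h1 h2 c0 a0; move: c0; rewrite le_eqVlt => /orP[/eqP c0|c0].
  by subst c; nra.
rewrite -subr_ge0 -(pmulr_rge0 _ c0); move: h2.
by congr (0 <= _); ring.
Qed.

Section bounded_measurable.
Context (R : realType) d (X : measurableType d).
Implicit Types f g : X -> R.

(** The bound holds everywhere, not just almost everywhere, so that every section of a bounded
    kernel stays in the class; integrability over a finite measure is automatic. *)
Definition bmf f := measurable_fun setT f /\ exists M : R, forall x, `|f x| <= M.

Lemma measurable_set_ge f (c : R) : measurable_fun setT f -> measurable [set x | c <= f x].
Proof.
move=> mf; rewrite -[X in measurable X]setTI.
have -> : [set x | c <= f x] = f @^-1` `[c, +oo[.
  by apply/seteqP; split => x /=; rewrite in_itv/= andbT.
exact: mf.
Qed.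

Lemma measurable_set_gt f (c : R) : measurable_fun setT f -> measurable [set x | c < f x].
Proof.
move=> mf; rewrite -[X in measurable X]setTI.
have -> : [set x | c < f x] = f @^-1` `]c, +oo[.
  by apply/seteqP; split => x /=; rewrite in_itv/= andbT.
exact: mf.
Qed.

Lemma measurable_set_lt f (c : R) : measurable_fun setT f -> measurable [set x | f x < c].
Proof.
move=> mf; rewrite -[X in measurable X]setTI.
have -> : [set x | f x < c] = f @^-1` `]-oo, c[.
  by apply/seteqP; split => x /=; rewrite in_itv.
exact: mf.
Qed.

Lemma bmf_cst (c : R) : bmf (fun=> c).
Proof. by split; [exact: measurable_cst | exists `|c|]. Qed.

Lemma bmfD f g : bmf f -> bmf g -> bmf (fun x => f x + g x).
Proof.
move=> [mf [M hM]] [mg [N hN]]; split; first exact: measurable_funD.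
by exists (M + N) => x; rewrite (le_trans (ler_normD _ _))// lerD.
Qed.

Lemma bmfB f g : bmf f -> bmf g -> bmf (fun x => f x - g x).
Proof.
move=> [mf [M hM]] [mg [N hN]]; split; first exact: measurable_funB.
by exists (M + N) => x; rewrite (le_trans (ler_normB _ _))// lerD.
Qed.

Lemma bmfM f g : bmf f -> bmf g -> bmf (fun x => f x * g x).
Proof.
move=> [mf [M hM]] [mg [N hN]]; split; first exact: measurable_funM.
by exists (M * N) => x; rewrite normrM ler_pM.
Qed.

Lemma bmfZ c f : bmf f -> bmf (fun x => c * f x).
Proof. exact/bmfM/bmf_cst. Qed.

Lemma bmf_sum (J : Type) (s : seq J) (F : J -> X -> R) :
  (forall j, bmf (F j)) -> bmf (fun x => \sum_(j <- s) F j x).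
Proof.
move=> hF; elim: s => [|j s IH].
  by under [X in bmf X]eq_fun do rewrite big_nil; exact: bmf_cst.
by under [X in bmf X]eq_fun do rewrite big_cons; exact: bmfD.
Qed.

Lemma bmf_indic (A : set X) : measurable A -> bmf (\1_A).
Proof.
move=> mA; split; first exact: measurable_indic.
by exists 1 => x; rewrite indicE; case: (_ \in _); rewrite ?normr1 ?normr0.
Qed.

Context (mu : {finite_measure set X -> \bar R}).

Lemma bmf_integrable f : bmf f -> mu.-integrable setT (EFin \o f).
Proof.
move=> [mf [M hM]]; apply: measurable_bounded_integrable => //.
  by rewrite ltey_eq fin_num_measure.
exists M; split => //; first by rewrite num_real.
by move=> r Mr x _ /=; rewrite (le_trans (hM x))// ltW.
Qed.

Local Notation I f := (\int[mu]_x f x).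

Lemma integD f g : bmf f -> bmf g -> I (fun x => f x + g x) = I f + I g.
Proof. by move=> hf hg; rewrite RintegralD//; exact: bmf_integrable. Qed.

Lemma integB f g : bmf f -> bmf g -> I (fun x => f x - g x) = I f - I g.
Proof. by move=> hf hg; rewrite RintegralB//; exact: bmf_integrable. Qed.

Lemma integZ c f : bmf f -> I (fun x => c * f x) = c * I f.
Proof. by move=> hf; rewrite RintegralZl//; exact: bmf_integrable. Qed.

Lemma integZr c f : bmf f -> I (fun x => f x * c) = I f * c.
Proof. by move=> hf; rewrite RintegralZr//; exact: bmf_integrable. Qed.

Lemma integ_cst c : I (fun=> c) = c * fine (mu setT).
Proof. by rewrite Rintegral_cst. Qed.

Lemma integ_ge0 f : (forall x, 0 <= f x) -> 0 <= I f.
Proof. by move=> f0; apply: Rintegral_ge0. Qed.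

Lemma integ_le f g : bmf f -> bmf g -> (forall x, f x <= g x) -> I f <= I g.
Proof. by move=> hf hg fg; apply: le_Rintegral => //; exact: bmf_integrable. Qed.

Lemma integ_sum (J : Type) (s : seq J) (F : J -> X -> R) :
  (forall j, bmf (F j)) ->
  I (fun x => \sum_(j <- s) F j x) = \sum_(j <- s) I (F j).
Proof.
move=> hF; elim: s => [|j s IH].
  under eq_Rintegral do rewrite big_nil.
  by rewrite integ_cst mul0r big_nil.
under eq_Rintegral do rewrite big_cons.
by rewrite integD ?IH ?big_cons//; exact: bmf_sum.
Qed.

Lemma integ_norm_le f (M : R) : bmf f -> (forall x, `|f x| <= M) ->
  `|I f| <= M * fine (mu setT).
Proof.
move=> hf hM; rewrite -integ_cst.
have := @integ_le f (fun=> M) hf (bmf_cst M).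
have := @integ_le (fun=> - M) f (bmf_cst _) hf.
rewrite !integ_cst mulNr ler_norml => h1 h2; apply/andP; split.
  by apply: h1 => x; move: (hM x); rewrite ler_norml => /andP[].
by apply: h2 => x; move: (hM x); rewrite ler_norml => /andP[].
Qed.

Lemma integ_EFin f : bmf f -> (\int[mu]_x (f x)%:E = (I f)%:E)%E.
Proof.
by move=> hf; rewrite /Rintegral fineK//; apply: integrable_fin_num => //;
  exact: bmf_integrable.
Qed.

Lemma integ_eq0_ae f : bmf f -> (forall x, 0 <= f x) -> I f = 0 ->
  {ae mu, forall x, f x = 0}.
Proof.
move=> hf f0 If.
have : (\int[mu]_x `|(f x)%:E| = 0)%E.
  under eq_integral do rewrite abse_EFin ger0_norm//.
  by rewrite integ_EFin// If.
move/(ae_eq_integral_abs mu measurableT).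
have mf : measurable_fun setT (EFin \o f) by apply/measurable_EFinP; exact: hf.1.
move=> /(_ mf); apply: filterS => x /= /(_ Logic.I); by case.
Qed.

Lemma eq_integ_ae f g : bmf f -> bmf g -> {ae mu, forall x, f x = g x} -> I f = I g.
Proof.
move=> hf hg fg; apply: EFin_inj; rewrite -!integ_EFin//.
apply: ae_eq_integral => //; [| |].
- by apply/measurable_EFinP; exact: hf.1.
- by apply/measurable_EFinP; exact: hg.1.
- by apply: filterS fg => x -> _.
Qed.

Lemma integ_indic A : measurable A -> I (\1_A) = fine (mu A).
Proof. by move=> mA; rewrite /Rintegral integral_indic// setIT. Qed.

Lemma bmf_bound f : bmf f -> exists2 M : R, 0 < M & forall x, `|f x| <= M.
Proof.
move=> [_ [M hM]]; exists (`|M| + 1); first by rewrite ltr_wpDl.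
by move=> x; rewrite (le_trans (hM x))// (le_trans (ler_norm _))// lerDl.
Qed.

(** The integral of [(s * f x - t * g x) ^+ 2] is a nonnegative quadratic form in [s], [t]. *)
Lemma integ_CS f g : bmf f -> bmf g ->
  (I (fun x => f x * g x)) ^+ 2 <= I (fun x => f x ^+ 2) * I (fun x => g x ^+ 2).
Proof.
move=> hf hg; apply: sqr_le_of_quad_ge0 => s t.
have hff := bmfM hf hf; have hgg := bmfM hg hg; have hfg := bmfM hf hg.
have : 0 <= I (fun x => (s * f x - t * g x) ^+ 2).
  by apply: integ_ge0 => x; exact: sqr_ge0.
under eq_Rintegral => x _.
  have -> : (s * f x - t * g x) ^+ 2 = (s ^+ 2 * (f x * f x)
    - (2 * s * t) * (f x * g x)) + t ^+ 2 * (g x * g x) by ring.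
  over.
rewrite integD ?integB ?integZ//; try by repeat apply: bmfB || apply: bmfZ.
Qed.

End bounded_measurable.

Lemma bmf_comp (R : realType) d d' (X : measurableType d) (Y : measurableType d')
  (h : Y -> X) (f : X -> R) :
  measurable_fun setT h -> bmf f -> bmf (f \o h).
Proof.
move=> mh [mf [M hM]]; split; first exact: measurableT_comp.
by exists M => x; exact: hM.
Qed.

(** * Functions of two variables and Fubini's theorem *)

Section two_variables.
Context (R : realType) d1 d2 (X : measurableType d1) (Y : measurableType d2).

Definition bmf2 (K : X -> Y -> R) := bmf (fun p : X * Y => K p.1 p.2).

Lemma bmf2_l K x : bmf2 K -> bmf (K x).
Proof. by move=> hK; apply: (bmf_comp (pair1_measurable x) hK). Qed.

Lemma bmf2_r K y : bmf2 K -> bmf (K^~ y).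
Proof. by move=> hK; apply: (bmf_comp (pair2_measurable y) hK). Qed.

Lemma bmf2_fst (f : X -> R) : bmf f -> bmf2 (fun x _ => f x).
Proof. by apply: bmf_comp; exact: measurable_fst. Qed.

Lemma bmf2_snd (f : Y -> R) : bmf f -> bmf2 (fun _ y => f y).
Proof. by apply: bmf_comp; exact: measurable_snd. Qed.

Lemma bmf2B (A B : X -> Y -> R) :
  bmf2 A -> bmf2 B -> bmf2 (fun x y => A x y - B x y).
Proof. exact: bmfB. Qed.

Lemma bmf2M (A B : X -> Y -> R) :
  bmf2 A -> bmf2 B -> bmf2 (fun x y => A x y * B x y).
Proof. exact: bmfM. Qed.

Lemma bmf2_sqr (A : X -> Y -> R) : bmf2 A -> bmf2 (fun x y => A x y ^+ 2).
Proof. by move=> hA; exact: bmfM. Qed.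

Lemma bmf2Z c (A : X -> Y -> R) : bmf2 A -> bmf2 (fun x y => c * A x y).
Proof. exact: bmfZ. Qed.

Lemma bmf2_cst c : bmf2 (fun _ _ => c).
Proof. exact: bmf_cst. Qed.

Context (nu : {finite_measure set Y -> \bar R}).

Lemma bmf_int K : bmf2 K -> bmf (fun x => \int[nu]_y K x y).
Proof.
move=> hK; have [M M0 hM] := bmf_bound hK; split; last first.
  exists (M * fine (nu setT)) => x; apply: integ_norm_le; first exact: bmf2_l.
  by move=> y; exact: (hM (x, y)).
(* Adding the bound [M] makes the integrand nonnegative, as Tonelli's measurability statement
   requires; the constant is subtracted afterwards. *)
have hKM : bmf (fun p : X * Y => K p.1 p.2 + M) by apply: bmfD => //; exact: bmf_cst.
have -> : (fun x => \int[nu]_y K x y) =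
    (fun x => \int[nu]_y (K x y + M) - M * fine (nu setT)).
  by apply/funext => x; rewrite integD ?integ_cst ?addrK//;
    [exact: bmf2_l | exact: bmf_cst].
apply: measurable_funB; last exact: measurable_cst.
apply: (measurableT_comp (fine_measurable measurableT)).
have := @measurable_fun_fubini_tonelli_F _ _ X Y R nu
  (fun p : X * Y => (K p.1 p.2 + M)%:E).
apply.
  by apply/measurable_EFinP; exact: hKM.1.
move=> p; rewrite lee_fin.
by move: (hM p); rewrite ler_norml => /andP[+ _]; lra.
Qed.

End two_variables.

Lemma bmf2_swap (R : realType) d1 d2 (X : measurableType d1)
    (Y : measurableType d2) (K : X -> Y -> R) :
  bmf2 K -> bmf2 (fun y x => K x y).
Proof. by move=> hK; apply: (bmf_comp (@measurable_swap _ _ Y X) hK). Qed.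

Section fubini.
Context (R : realType) d1 d2 (X : measurableType d1) (Y : measurableType d2).
Context (mu : {finite_measure set X -> \bar R}) (nu : {finite_measure set Y -> \bar R}).
Implicit Types K : X -> Y -> R.

Lemma integ_fubini K : bmf2 K ->
  \int[mu]_x \int[nu]_y K x y = \int[nu]_y \int[mu]_x K x y.
Proof.
move=> hK; have [M M0 hM] := bmf_bound hK.
have KI : (mu \x nu)%E.-integrable setT (fun p => (K p.1 p.2)%:E).
  apply/integrable12ltyP; first by apply/measurable_EFinP; exact: hK.1.
  apply: (@le_lt_trans _ _ (\int[mu]_x (M * fine (nu setT))%:E)%E); last first.
    by rewrite integ_EFin ?ltry//; exact: bmf_cst.
  apply: ge0_le_integral => //.
  - by move=> x _; apply: integral_ge0.
  - apply: (measurable_fun_fubini_tonelli_F (fun p : X * Y => `|(K p.1 p.2)%:E|%E)) => //.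
    by apply: measurableT_comp => //; apply/measurable_EFinP; exact: hK.1.
  move=> x _; apply: (@le_trans _ _ (\int[nu]_y M%:E)%E).
    apply: ge0_le_integral => //=.
    - apply: measurableT_comp => //; apply: measurableT_comp => //.
      exact: (bmf2_l x hK).1.
    - by move=> y _; rewrite lee_fin; exact: (hM (x, y)).
  by rewrite integ_EFin ?integ_cst//; exact: bmf_cst.
apply: EFin_inj; rewrite -!integ_EFin//; [|exact/bmf_int/bmf2_swap|exact: bmf_int].
rewrite (eq_integral (fun x => \int[nu]_y (K x y)%:E)%E); last first.
  by move=> x _; rewrite integ_EFin//; exact: bmf2_l.
rewrite [RHS](eq_integral (fun y => \int[mu]_x (K x y)%:E)%E); last first.
  by move=> y _; rewrite integ_EFin//; exact: bmf2_r.
exact: (Fubini KI).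
Qed.

End fubini.

(** * Bounded kernels *)

Section kernels.
Context (R : realType) d (X : measurableType d) (mu : {finite_measure set X -> \bar R}).
Implicit Types (A B C K M : X -> X -> R).
Local Notation I f := (\int[mu]_x f x).

Definition int2 K := \int[mu]_x \int[mu]_y K x y.

(** The kernel of the composite of the two integral operators. *)
Definition kmul A B x y := \int[mu]_s (A x s * B s y).

Lemma bmf2_kmul A B : bmf2 A -> bmf2 B -> bmf2 (kmul A B).
Proof.
move=> hA hB.
apply: (@bmf_int R _ _ (X * X)%type X mu (fun p s => A p.1 s * B s p.2)).
apply: bmfM.
- apply: (bmf_comp (h := fun q : (X * X) * X => (q.1.1, q.2)) _ hA).
  apply: measurable_fun_pair => //.
  exact: (measurableT_comp measurable_fst measurable_fst).
- apply: (bmf_comp (h := fun q : (X * X) * X => (q.2, q.1.2)) _ hB).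
  apply: measurable_fun_pair => //.
  exact: (measurableT_comp measurable_snd measurable_fst).
Qed.

Lemma kmulA A B C : bmf2 A -> bmf2 B -> bmf2 C ->
  kmul A (kmul B C) = kmul (kmul A B) C.
Proof.
move=> hA hB hC; apply/funext => x; apply/funext => y; rewrite /kmul.
transitivity (\int[mu]_s \int[mu]_t (A x s * B s t * C t y)).
  apply: eq_Rintegral => s _; rewrite -integZ; last first.
    by apply: bmfM; [exact: bmf2_l | exact: bmf2_r].
  by apply: eq_Rintegral => t _; rewrite mulrA.
rewrite integ_fubini; last first.
  apply: bmfM; last exact: (bmf2_snd _ (bmf2_r y hC)).
  by apply: bmfM => //; exact: (bmf2_fst _ (bmf2_l x hA)).
apply: eq_Rintegral => t _; rewrite -integZr//.
by apply: bmfM; [exact: bmf2_l | exact: bmf2_r].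
Qed.

Lemma int2_ge0 K : (forall x y, 0 <= K x y) -> 0 <= int2 K.
Proof. by move=> K0; apply: integ_ge0 => x; exact: integ_ge0. Qed.

Lemma int2D A B : bmf2 A -> bmf2 B ->
  int2 (fun x y => A x y + B x y) = int2 A + int2 B.
Proof.
move=> hA hB; rewrite /int2 -integD; [|exact: bmf_int..].
by apply: eq_Rintegral => x _; rewrite integD//; exact: bmf2_l.
Qed.

Lemma int2B A B : bmf2 A -> bmf2 B ->
  int2 (fun x y => A x y - B x y) = int2 A - int2 B.
Proof.
move=> hA hB; rewrite /int2 -integB; [|exact: bmf_int..].
by apply: eq_Rintegral => x _; rewrite integB//; exact: bmf2_l.
Qed.

Lemma int2Z c A : bmf2 A -> int2 (fun x y => c * A x y) = c * int2 A.
Proof.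
move=> hA; rewrite /int2 -integZ; last exact: bmf_int.
by apply: eq_Rintegral => x _; rewrite integZ//; exact: bmf2_l.
Qed.

Lemma int2_le A B : bmf2 A -> bmf2 B -> (forall x y, A x y <= B x y) ->
  int2 A <= int2 B.
Proof.
move=> hA hB AB; apply: integ_le; [exact: bmf_int..|move=> x].
by apply: integ_le => //; exact: bmf2_l.
Qed.

Lemma eq_int2 A B : (forall x y, A x y = B x y) -> int2 A = int2 B.
Proof. by move=> AB; apply: eq_Rintegral => x _; apply: eq_Rintegral => y _. Qed.

Lemma int2_cst c : int2 (fun _ _ => c) = c * fine (mu setT) ^+ 2.
Proof. by rewrite /int2 !integ_cst expr2 mulrA. Qed.

Lemma int2_prod f g : bmf f -> bmf g -> int2 (fun x y => f x * g y) = I f * I g.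
Proof.
move=> hf hg; rewrite /int2 -integZr//; apply: eq_Rintegral => x _.
by rewrite integZ.
Qed.

Lemma int2_sqr_lincomb s t A B : bmf2 A -> bmf2 B ->
  int2 (fun x y => (s * A x y - t * B x y) ^+ 2) =
  s ^+ 2 * int2 (fun x y => A x y ^+ 2)
  - 2 * s * t * int2 (fun x y => A x y * B x y)
  + t ^+ 2 * int2 (fun x y => B x y ^+ 2).
Proof.
move=> hA hB; have hAA := bmf2_sqr hA; have hBB := bmf2_sqr hB.
have hAB := bmf2M hA hB.
rewrite -!int2Z// -int2B; [|exact: bmf2Z..].
rewrite -int2D; [|by apply: bmf2B; exact: bmf2Z|exact: bmf2Z].
by apply: eq_int2 => x y; ring.
Qed.

Lemma int2_sqrB A B : bmf2 A -> bmf2 B ->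
  int2 (fun x y => (A x y - B x y) ^+ 2) =
  int2 (fun x y => A x y ^+ 2) - 2 * int2 (fun x y => A x y * B x y)
  + int2 (fun x y => B x y ^+ 2).
Proof.
move=> hA hB; have := int2_sqr_lincomb 1 1 hA hB.
rewrite expr1n !mul1r !mulr1 => <-; apply: eq_int2 => x y.
by rewrite !mul1r.
Qed.

Lemma int2_CS A B : bmf2 A -> bmf2 B ->
  int2 (fun x y => A x y * B x y) ^+ 2 <=
  int2 (fun x y => A x y ^+ 2) * int2 (fun x y => B x y ^+ 2).
Proof.
move=> hA hB; apply: sqr_le_of_quad_ge0 => s t; rewrite -int2_sqr_lincomb//.
by apply: int2_ge0 => x y; exact: sqr_ge0.
Qed.

(** Submultiplicativity of the Hilbert-Schmidt norm: Cauchy-Schwarz for each pair [x], [y] bounds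
    the square by a function of [x] times a function of [y]. *)
Lemma int2_kmul_le A B : bmf2 A -> bmf2 B ->
  int2 (fun x y => kmul A B x y ^+ 2) <=
  int2 (fun x y => A x y ^+ 2) * int2 (fun x y => B x y ^+ 2).
Proof.
move=> hA hB; have hAA := bmf2_sqr hA; have hBB := bmf2_sqr hB.
have hAB := bmf2_kmul hA hB.
rewrite {3}/int2 integ_fubini//.
have h1 := bmf_int mu hAA; have h2 := bmf_int mu (bmf2_swap hBB).
rewrite -(int2_prod h1 h2); apply: int2_le => //.
- exact: bmf2_sqr.
- by apply: bmf2M; [exact: (bmf2_fst _ h1) | exact: (bmf2_snd _ h2)].
- by move=> x y; apply: integ_CS; [exact: bmf2_l | exact: bmf2_r].
Qed.

(* Indices are shifted: [kpow M n] is the (n+1)-st power of [M]. *)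
Fixpoint kpow M n := if n is n'.+1 then kmul M (kpow M n') else M.

Context (M : X -> X -> R) (hM : bmf2 M).

Lemma bmf2_kpow n : bmf2 (kpow M n).
Proof. by elim: n => //= n IH; exact: bmf2_kmul. Qed.

Lemma kpowD a b : kmul (kpow M a) (kpow M b) = kpow M (a + b).+1.
Proof.
elim: a => [|a IH]; first by [].
by rewrite /= -kmulA ?IH//; exact: bmf2_kpow.
Qed.

Hypothesis M_sym : forall x y, M x y = M y x.

Lemma kpow_sym n x y : kpow M n x y = kpow M n y x.
Proof.
elim: n x y => [|n IH] x y; first exact: M_sym.
have -> : kpow M n.+1 x y = kmul (kpow M n) (kpow M 0) x y by rewrite kpowD addn0.
by apply: eq_Rintegral => s _; rewrite IH (M_sym y) mulrC.
Qed.

Definition ktr n := \int[mu]_x kpow M n x x.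

(** By symmetry the Hilbert-Schmidt pairing of two powers is the trace of their product, so it
    depends on [a + b] alone. Log-convexity and the inner products in the power method rest on
    this. *)
Lemma int2_kpowM a b :
  int2 (fun x y => kpow M a x y * kpow M b x y) = ktr (a + b).+1.
Proof.
apply: eq_Rintegral => x _; rewrite -kpowD /kmul; apply: eq_Rintegral => y _.
by rewrite (kpow_sym b).
Qed.

End kernels.

(** * Kernels that vanish almost everywhere *)

Section null_kernels.
Context (R : realType) d (X : measurableType d) (mu : {finite_measure set X -> \bar R}).
Implicit Types (K : X -> X -> R) (A B : set X) (E : set (X * X)).
Local Notation I f := (\int[mu]_x f x).
Local Notation mu2 := (mu \x mu)%E.

Lemma prod_fin_num E : measurable E -> mu2 E \is a fin_num.
Proof.
move=> mE; rewrite ge0_fin_numE//.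
apply: (@le_lt_trans _ _ (mu2 setT)); first by rewrite le_measure ?inE.
rewrite -setXTT product_measure1E// lte_mul_pinfty//; first exact: fin_num_measure.
by rewrite ltey_eq fin_num_measure.
Qed.

Lemma bmf2_indic E : measurable E -> bmf2 (fun x y => \1_E (x, y) : R).
Proof.
move=> mE; have := bmf_indic R mE; rewrite /bmf2.
by congr (bmf _); apply/funext => -[].
Qed.

Lemma int2_indic E : measurable E ->
  int2 mu (fun x y => \1_E (x, y)) = fine (mu2 E).
Proof.
move=> mE; rewrite /int2 /= /product_measure1 /Rintegral; congr fine.
apply: eq_integral => x _ /=.
rewrite (_ : (fun y => _) = fun y => (\1_(xsection E x) y)%:E); last first.
  by apply/funext => y; rewrite !indicE mem_xsection.
rewrite integral_indic//; last exact: measurable_xsection.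
by rewrite setIT fineK// fin_num_measure//; exact: measurable_xsection.
Qed.

Lemma int2_norm_le K E (c : R) : bmf2 K -> measurable E ->
  (forall x y, `|K x y| <= c * \1_E (x, y)) -> `|int2 mu K| <= c * fine (mu2 E).
Proof.
move=> hK mE h; have hE := bmf2_indic mE.
rewrite -int2_indic// -int2Z// ler_norml.
apply/andP; split; last first.
  by apply: int2_le => //; [exact: bmf2Z|move=> x y; rewrite (le_trans (ler_norm _))].
rewrite -mulN1r -int2Z; last exact: bmf2Z.
apply: int2_le => //; first by do 2 apply: bmf2Z.
by move=> x y; move: (h x y); rewrite ler_norml mulN1r => /andP[].
Qed.

Lemma int2_setD K E F : bmf2 K -> measurable E -> measurable F -> F `<=` E ->
  int2 mu (fun x y => K x y * \1_(E `\` F) (x, y)) =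
  int2 mu (fun x y => K x y * \1_E (x, y)) - int2 mu (fun x y => K x y * \1_F (x, y)).
Proof.
move=> hK mE mF FE; rewrite -int2B; last 2 first.
- exact: (bmf2M hK (bmf2_indic mE)).
- exact: (bmf2M hK (bmf2_indic mF)).
apply: eq_int2 => x y; rewrite -mulrBr; congr (_ * _).
rewrite !indicE in_setD; have [yF|_] := boolP (_ \in F); last by rewrite andbT subr0.
by move: yF => /set_mem /FE /mem_set ->; rewrite subrr.
Qed.

(** Dynkin's argument: rectangles are stable under intersection and generate the product
    sigma-algebra, and the sets over which [K] integrates to zero form a lambda-system. *)
Lemma int2_rect_eq0 K : bmf2 K ->
  (forall A B, measurable A -> measurable B ->
    int2 mu (fun x y => K x y * (\1_A x * \1_B y)) = 0) ->
  forall E, measurable E -> int2 mu (fun x y => K x y * \1_E (x, y)) = 0.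
Proof.
move=> hK hrect.
have [c c0 hc] := bmf_bound hK.
pose H := [set E : set (X * X) | measurable E /\
  int2 mu (fun x y => K x y * \1_E (x, y)) = 0].
pose G := [set C | exists2 A, measurable A & exists2 B, measurable B & A `*` B = C]
  : set (set (X * X)).
suff GH : <<s G >> `<=` H.
  by move=> E; rewrite measurable_prod_measurableType => /GH[].
apply: lambda_system_subset => //.
- move=> _ _ [A mA [B mB <-]] [A' mA' [B' mB' <-]]; rewrite -setXI.
  by exists (A `&` A'); [exact: measurableI|exists (B `&` B') => //; exact: measurableI].
- split.
  + by [].
  + split; first exact: measurableT.
    rewrite -(hrect setT setT measurableT measurableT); apply: eq_int2 => x y.
    by rewrite !indicT !mulr1.
  + move=> E F FE [mE hE] [mF hF]; split; first exact: measurableD.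
    by rewrite int2_setD// hE hF subrr.
  + move=> F ndF hF; have mF n := (hF n).1.
    have mU : measurable (\bigcup_n F n) by exact: bigcupT_measurable.
    split => //; apply/eqP; rewrite -normr_eq0 eq_le normr_ge0 andbT.
    (* Increasing unions: the integral over the union differs from the zero integral over [F n] by
       at most the bound of [K] times the measure of the difference. *)
    pose D n := c * (fine (mu2 (\bigcup_n F n)) - fine (mu2 (F n))).
    have D0 : D @ \oo --> 0.
      rewrite -(mulr0 c); apply: cvgMl_tmp.
      rewrite -(subrr (fine (mu2 (\bigcup_n F n)))); apply: cvgB; first exact: cvg_cst.
      apply: fine_cvg; rewrite fineK; last exact: prod_fin_num.
      exact: nondecreasing_cvg_mu.
    apply: (cvgr_to_ge D0); apply: nearW => n.
    have FU : F n `<=` \bigcup_n F n by move=> p Fp; exists n.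
    rewrite -[X in `|X|]subr0 -(hF n).2 -int2_setD// /D -fineB ?prod_fin_num//.
    have muD : mu2 (\bigcup_n F n `\` F n) = (mu2 (\bigcup_n F n) - mu2 (F n))%E.
      rewrite -[in RHS](setIidr FU); apply: measureD => //.
      by rewrite ltey_eq prod_fin_num.
    rewrite -muD.
    have mD : measurable (\bigcup_n F n `\` F n) by exact: measurableD.
    apply: int2_norm_le => //; first exact: (bmf2M hK (bmf2_indic mD)).
    move=> x y; rewrite normrM ler_pM// ?(hc (x, y))// ger0_norm//.
- move=> _ [A mA [B mB <-]]; split; first exact: measurableX.
  apply: etrans (hrect A B mA mB); apply: eq_int2 => x y; congr (_ * _).
  by rewrite !indicE in_setX; case: (_ \in A); case: (_ \in B); rewrite ?mulr1 ?mulr0.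
Qed.

(** With [P] the set where [K] is nonnegative, the integral of [|K|] is the difference of the
    integrals of [K] over [P] and its complement, and [K ^+ 2 <= c * |K|]. *)
Lemma int2_sqr_eq0 K : bmf2 K ->
  (forall E, measurable E -> int2 mu (fun x y => K x y * \1_E (x, y)) = 0) ->
  int2 mu (fun x y => K x y ^+ 2) = 0.
Proof.
move=> hK hE; have [c c0 hc] := bmf_bound hK.
pose P := [set p : X * X | 0 <= K p.1 p.2].
have mP : measurable P by apply: measurable_set_ge; exact: hK.1.
have mN : measurable (~` P) by exact: measurableC.
have hKP := bmf2M hK (bmf2_indic mP); have hKN := bmf2M hK (bmf2_indic mN).
apply/eqP; rewrite eq_le int2_ge0 ?andbT; last by move=> x y; exact: sqr_ge0.
rewrite -(mulr0 c) -(subrr 0) -{1}(hE _ mP) -(hE _ mN) -int2B// -int2Z; last exact: bmf2B.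
apply: int2_le; [exact: bmf2_sqr|exact/bmf2Z/bmf2B|move=> x y].
rewrite -mulrBr !indicE in_setC; have := hc (x, y); rewrite /= ler_norml => /andP[].
have [/set_mem|/negP xyP] := boolP (_ \in P); rewrite /P /=.
  by rewrite subr0 mulr1; nra.
have : ~ 0 <= K x y by move=> h; apply: xyP; rewrite inE.
by move/negP; rewrite -ltNge sub0r; nra.
Qed.

(* The integral of [K K^* (f (x) f)] is the square norm of [K^* f]; hence [K]
   integrates to zero on every rectangle. *)
Lemma kmul_adj_eq0 K : bmf2 K ->
  int2 mu (fun x y => kmul mu K (fun s z => K z s) x y ^+ 2) = 0 ->
  int2 mu (fun x y => K x y ^+ 2) = 0.
Proof.
move=> hK hG; set G := kmul mu K _ in hG; have hKT := bmf2_swap hK.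
have bG : bmf2 G by exact: bmf2_kmul.
pose h (f : X -> R) s := \int[mu]_x (K x s * f x).
have bKf f : bmf f -> bmf2 (fun x s => K x s * f x).
  by move=> bf; exact: (bmf2M hK (bmf2_fst _ bf)).
have bh f : bmf f -> bmf (h f).
  by move=> bf; exact: (bmf_int mu (bmf2_swap (bKf f bf))).
have h0 f : bmf f -> \int[mu]_s (h f s ^+ 2) = 0.
  move=> bf; have bff : bmf2 (fun x y => f x * f y).
    exact: (bmf2M (bmf2_fst _ bf) (bmf2_snd _ bf)).
  have := int2_CS mu bG bff; rewrite hG mul0r => hle.
  have : int2 mu (fun x y => G x y * (f x * f y)) = 0.
    by apply/eqP; rewrite -sqrf_eq0 eq_le hle sqr_ge0.
  move=> <-; rewrite /int2.
  transitivity (\int[mu]_x \int[mu]_s (K x s * f x * h f s)).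
    rewrite integ_fubini; last by apply: (bmf2M (bKf f bf)); exact: (bmf2_snd _ (bh f bf)).
    apply: eq_Rintegral => s _; rewrite integZr ?expr2//.
    exact: (bmf2_r s (bKf f bf)).
  apply: eq_Rintegral => x _.
  transitivity (f x * \int[mu]_y (G x y * f y)); last first.
    rewrite -integZ; last by apply: bmfM => //; exact: bmf2_l.
    by apply: eq_Rintegral => y _; ring.
  transitivity (f x * \int[mu]_s (K x s * h f s)).
    rewrite -integZ; last by apply: bmfM; [exact: bmf2_l | exact: bh].
    by apply: eq_Rintegral => s _; ring.
  congr (_ * _).
  transitivity (\int[mu]_s \int[mu]_y (K x s * (K y s * f y))).
    apply: eq_Rintegral => s _; rewrite integZ//; exact: (bmf2_r s (bKf f bf)).
  rewrite integ_fubini; last first.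
    by apply: bmf2M; [exact: (bmf2_fst _ (bmf2_l x hK)) | exact: bmf2_swap (bKf f bf)].
  apply: eq_Rintegral => y _; rewrite /G /kmul -integZr//.
    by apply: eq_Rintegral => s _; rewrite mulrA.
  by apply: bmfM; exact: bmf2_l.
apply: (int2_sqr_eq0 hK); apply: (int2_rect_eq0 hK) => A B mA mB.
have bA := bmf_indic R mA; have bB := bmf_indic R mB.
transitivity (\int[mu]_s (\1_B s * h \1_A s)).
  rewrite /int2 integ_fubini; last first.
    by apply: (bmf2M hK); exact: (bmf2M (bmf2_fst _ bA) (bmf2_snd _ bB)).
  apply: eq_Rintegral => s _; rewrite -integZ; last exact: (bmf2_r s (bKf _ bA)).
  by apply: eq_Rintegral => x _; ring.
have := integ_CS mu bB (bh _ bA); rewrite (h0 _ bA) mulr0 => hle.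
by apply/eqP; rewrite -sqrf_eq0 eq_le hle sqr_ge0.
Qed.

End null_kernels.

(** * Power method *)

Lemma bernoulli_le (R : realDomainType) (x : R) n : 1 <= x -> 1 + n%:R * (x - 1) <= x ^+ n.
Proof.
move=> x1; elim: n => [|n IH]; first by rewrite mul0r addr0 expr0.
rewrite exprS -natr1; have x0 : 0 <= x by rewrite (le_trans _ x1).
apply: le_trans (ler_wpM2l x0 IH); rewrite -subr_ge0.
have -> : x * (1 + n%:R * (x - 1)) - (1 + (n%:R + 1) * (x - 1)) =
  n%:R * (x - 1) ^+ 2 by ring.
by rewrite mulr_ge0// sqr_ge0.
Qed.

(** Bernoulli's inequality sends the powers of [x > 1] past any bound. *)
Lemma expr_bounded_le1 (R : realType) (x c : R) (n0 : nat) :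
  (forall n, (n0 <= n)%N -> x ^+ n <= c) -> x <= 1.
Proof.
move=> h; rewrite leNgt; apply/negP => x1.
have d0 : 0 < x - 1 by rewrite subr_gt0.
pose n := (n0 + Num.bound (`|c| / (x - 1)))%N.
have := h n (leq_addr _ _); have := bernoulli_le n (ltW x1).
have : `|c| < n%:R * (x - 1).
  rewrite -ltr_pdivrMr// (lt_le_trans (archi_boundP _))//.
    by rewrite divr_ge0// ltW.
  by rewrite ler_nat leq_addl.
have := ler_norm c; lra.
Qed.

(* [t n] will be the square norm of the (n+1)-st power of a kernel, whence the
   shifted indices. *)
Section logconvex.
Context (R : realType) (t : nat -> R).
Hypothesis t_gt0 : forall n, 0 < t n.
Hypothesis t_logconvex : forall n, t n.+1 ^+ 2 <= t n * t n.+2.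
Hypothesis t_submul : forall a b, t (a + b).+1 <= t a * t b.

Let r n := t n.+1 / t n.

Let tS n : t n.+1 = r n * t n.
Proof. by rewrite /r divfK// gt_eqF. Qed.

Let r_gt0 n : 0 < r n. Proof. exact: divr_gt0. Qed.

Let r_nd : nondecreasing_seq r.
Proof.
apply/nondecreasing_seqP => n; rewrite /r ler_pdivrMr// mulrAC ler_pdivlMr//.
by rewrite -expr2 mulrC.
Qed.

Let t_ge n k : (n <= k)%N -> t n * r n ^+ (k - n) <= t k.
Proof.
move=> /subnKC <-; move: (k - n)%N => {}k; rewrite addKn.
elim: k => [|k IH]; first by rewrite addn0 expr0 mulr1.
rewrite addnS tS exprS mulrCA ler_pM//.
- exact/ltW.
- by rewrite mulr_ge0 ?exprn_ge0//; exact/ltW.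
- by apply: r_nd; exact: leq_addr.
Qed.

(** With the shift, index [(m.+1 * j.+1).-1] stands for the exponent [m.+1 * j.+1], that is, for the
    (j+1)-st power of the one at index [m]. *)
Let t_pow m j : t (m.+1 * j.+1).-1 <= t m ^+ j.+1.
Proof.
elim: j => [|j IH]; first by rewrite muln1 expr1.
have -> : (m.+1 * j.+2).-1 = (m + (m.+1 * j.+1).-1).+1.
  by rewrite -addnS prednK// mulnS.
by rewrite exprS (le_trans (t_submul _ _))// ler_pM2l.
Qed.

(* Compares both growth rates along the indices [m.+1 * j.+1]. *)
Let r_le n m : r n ^+ m.+1 <= t m.
Proof.
rewrite -[leRHS]mul1r -ler_pdivrMr//.
apply: (@expr_bounded_le1 _ _ (r n ^+ n.+1 / t n) n.+1) => -[//|j] nj.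
rewrite expr_div_n ler_pdivrMr ?exprn_gt0// mulrAC ler_pdivlMr// -exprM.
have nk : (n.+1 <= m.+1 * j.+1)%N by rewrite (leq_trans nj)// leq_pmull.
have nk1 : (n <= (m.+1 * j.+1).-1)%N by rewrite -ltnS prednK.
rewrite -(subnKC nk) exprD -mulrA ler_pM2l ?exprn_gt0//.
apply: le_trans (t_pow m j); apply: le_trans (t_ge nk1).
rewrite mulrC ler_pM2l// le_eqVlt; apply/orP; left; apply/eqP; congr (_ ^+ _).
Qed.

(** [L] is the limit of the ratios [r n], which increase and stay below [t 0]. Passing to the limit
    in [r_le] gives the lower bound; [r n <= L] gives the monotonicity. For a kernel [M], [L] is the
    top eigenvalue of its square. *)
Lemma logconvex_growth : exists2 L : R, 0 < L &
  (forall n, L ^+ n.+1 <= t n) /\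
  nonincreasing_seq (fun n => t n / L ^+ n.+1).
Proof.
have rc : cvgn r.
  apply: nondecreasing_is_cvgn => //; exists (t 0) => _ [n _ <-].
  by have := r_le n 0; rewrite expr1.
have rL n : r n <= limn r by apply: nondecreasing_cvgn_le.
have L0 : 0 < limn r by exact: lt_le_trans (r_gt0 0) (rL 0).
exists (limn r) => //; split.
  move=> n; have : (fun m => r m ^+ n.+1) @ \oo --> (limn r) ^+ n.+1.
    exact: (continuous_cvg _ (@exprn_continuous R n.+1 (limn r)) rc).
  by move=> h; apply: (cvgr_to_le h); apply: nearW => m; exact: r_le.
apply/nonincreasing_seqP => n; rewrite tS (exprS _ n.+1) invfM mulrACA.
rewrite ger_pMl ?divr_gt0 ?exprn_gt0//.
by rewrite ler_pdivrMr// mul1r.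
Qed.

End logconvex.

Lemma uniform_cauchy_limit (R : realType) d (X : measurableType d)
    (F : nat -> X -> R) : (forall n, bmf (F n)) ->
  (forall e : R, 0 < e -> exists n0, forall n m, (n0 <= n)%N -> (n0 <= m)%N ->
    forall x, `|F n x - F m x| <= e) ->
  exists2 G : X -> R, bmf G & forall e : R, 0 < e ->
    exists n0, forall n, (n0 <= n)%N -> forall x, `|F n x - G x| <= e.
Proof.
move=> hF hc.
have cF x : cvgn (F ^~ x).
  apply/cauchy_cvgP/cauchyP => e e0.
  have e2 : 0 < e / 2 by rewrite divr_gt0.
  have [n0 hn0] := hc _ e2.
  exists (F n0 x); exists n0 => //= n nn0.
  rewrite -ball_normE /= (@le_lt_trans _ _ (e / 2))//; last lra.
  exact: hn0.
pose G x := limn (F ^~ x).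
have hG e : 0 < e -> exists n0, forall n, (n0 <= n)%N -> forall x, `|F n x - G x| <= e.
  move=> e0; have [n0 hn0] := hc e e0; exists n0 => n nn0 x.
  have : (fun m => `|F n x - F m x|) @ \oo --> `|F n x - G x|.
    by apply: cvg_norm; apply: cvgB; [exact: cvg_cst | exact: cF].
  move=> h; apply: (cvgr_to_le h); near=> m; apply: hn0 => //.
  by near: m; exists n0.
exists G => //; split.
  by apply: (@measurable_fun_cvg _ _ _ setT F) => [n|x _]; [exact: (hF n).1|exact: cF].
have [n0 hn0] := hG 1 ltr01; have [c c0 hcc] := bmf_bound (hF n0).
exists (c + 1) => x; have := hn0 n0 (leqnn _) x; have := hcc x.
move=> h1 h2; rewrite -[G x](subKr (F n0 x)).
by rewrite (le_trans (ler_normB _ _))// lerD.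
Unshelve. all: by end_near. Qed.

Lemma eq0_norm_le (R : realFieldType) (x k : R) : 0 <= k ->
  (forall e, 0 < e -> `|x| <= k * e) -> x = 0.
Proof.
move=> k0 h; apply/eqP; rewrite -normr_eq0 eq_le normr_ge0 andbT leNgt; apply/negP => x0.
have k1 : 0 < k + 1 by rewrite ltr_wpDl.
have := h (`|x| / (k + 1)) (divr_gt0 x0 k1); apply/negP; rewrite -ltNge.
by rewrite mulrCA gtr_pMr// ltr_pdivrMr// mul1r ltrDl.
Qed.

Section power_method.
Context (R : realType) d (X : measurableType d) (mu : {finite_measure set X -> \bar R}).
Context (M : X -> X -> R) (hM : bmf2 M) (M_sym : forall x y, M x y = M y x).
Hypothesis M_neq0 : 0 < int2 mu (fun x y => M x y ^+ 2).

Local Notation P := (kpow mu M).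
Local Notation hP := (bmf2_kpow mu hM).
Let t n := int2 mu (fun x y => P n x y ^+ 2).

Let tE n : t n = ktr mu M (n + n).+1.
Proof. by rewrite -int2_kpowM//; apply: eq_int2 => x y; rewrite expr2. Qed.

Let t_ge0 n : 0 <= t n.
Proof. by apply: int2_ge0 => x y; exact: sqr_ge0. Qed.

Let t_submul a b : t (a + b).+1 <= t a * t b.
Proof. by rewrite {1}/t -kpowD//; apply: int2_kmul_le; exact: hP. Qed.

(** The (2n+2)-nd power is the (n+1)-st power times its own adjoint, hence nonzero by
    [kmul_adj_eq0]. *)
Let t_double n : 0 < t n -> 0 < t (n + n).+1.
Proof.
move=> tn; rewrite lt_neqAle t_ge0 andbT; apply/eqP => h.
suff tn0 : t n = 0 by rewrite tn0 ltxx in tn.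
apply: (kmul_adj_eq0 (hP n)); rewrite h; apply: eq_int2 => x y.
rewrite -(kpowD mu hM n n) /kmul; congr (_ ^+ 2); apply: eq_Rintegral => s _.
by rewrite (kpow_sym mu hM M_sym n y).
Qed.

Let t_gt0 n : 0 < t n.
Proof.
elim: n => [//|n IH]; have := t_double IH.
(* Positivity at [n.+1] passes to the index [2 * n + 3], and submultiplicativity bounds that term by
   [t n.+2 * t n], so [t n.+2] cannot vanish. *)
case: n IH => [//|n] IH; have -> : (n.+1 + n.+1).+1 = (n.+2 + n).+1.
  by rewrite addnS addSn.
move=> /lt_le_trans/(_ (t_submul _ _)) => h.
rewrite lt_neqAle t_ge0 andbT eq_sym; apply/eqP => h0.
by move: h; rewrite h0 mul0r ltxx.
Qed.

(** Cauchy-Schwarz for the powers at [n] and [n.+2], whose pairing is the same trace as the square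
    norm at [n.+1]. *)
Let t_logconvex n : t n.+1 ^+ 2 <= t n * t n.+2.
Proof.
rewrite {1}tE; have -> : (n.+1 + n.+1).+1 = (n + n.+2).+1 by rewrite !addnS addSn.
rewrite -(int2_kpowM mu hM M_sym); exact: (int2_CS mu (hP _) (hP _)).
Qed.

(* [N n], a normalised even power of [M], is Cauchy in quadratic mean; multiplying
   by [M^2] on both sides turns this into uniform convergence. *)
Lemma sym_kernel_eigenfunction : exists2 L : R, 0 < L & exists f : X -> R,
  [/\ bmf f, forall x, \int[mu]_y (kmul mu M M x y * f y) = L * f x &
      exists x, f x != 0].
Proof.
have [L L0 [tL a_ni]] := logconvex_growth t_gt0 t_logconvex t_submul.
exists L => //; pose a n := t n / L ^+ n.+1.
pose N n x y := (L ^+ n.+1)^-1 * P (n + n).+1 x y.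
have hN n : bmf2 (N n) by exact: (bmf2Z _ (hP _)).
(* Inner products depend on [n + m] only, so the square distance between [N n] and [N m] combines
   three terms of the sequence [a], which converges. *)
have NN n m : int2 mu (fun x y => N n x y * N m x y) = a (n + m).+1.
  rewrite /a tE mulrC.
  have -> : ((n + m).+1 + (n + m).+1).+1 = ((n + n).+1 + (m + m).+1).+1 by lia.
  rewrite -int2_kpowM// -int2Z; last by apply: bmf2M; exact: hP.
  apply: eq_int2 => x y; rewrite /N.
  have -> : (n + m).+2 = (n.+1 + m.+1)%N by rewrite addnS addSn.
  by rewrite exprD invfM; ring.
have ac : cvgn a.
  apply: nonincreasing_is_cvgn => //; exists 0 => _ [n _ <-].
  exact: divr_ge0 (t_ge0 n) (exprn_ge0 _ (ltW L0)).
have hL := gt_eqF L0.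
have [c c0 hc] := bmf_bound (hP 1).
(* [c] bounds the square of [M]; [D] bounds the square norm of the weight that [NE] pairs with
   [N k]. *)
pose D := (c * c / L ^+ 2) ^+ 2 * fine (mu setT) ^+ 2.
have D0 : 0 <= D by rewrite mulr_ge0// sqr_ge0.
have NC n m x y : (N n.+2 x y - N m.+2 x y) ^+ 2 <=
    D * (a (n + n).+1 - 2 * a (n + m).+1 + a (m + m).+1).
  have hw : bmf2 (fun s u => P 1 x s * P 1 u y).
    by apply: bmf2M; [exact: (bmf2_fst _ (bmf2_l x (hP 1)))|
                      exact: (bmf2_snd _ (bmf2_r y (hP 1)))].
  (* [N k.+2] is [N k] multiplied by the square of [M] on both sides and divided by [L ^+ 2]; its
     value at a point is thus the pairing of [N k] with a bounded weight. *)
  have NE k : N k.+2 x y = int2 mu (fun s u => (L ^+ 2)^-1 * (P 1 x s * P 1 u y) * N k s u).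
    rewrite /N; have -> : (k.+2 + k.+2).+1 = (1 + ((k + k).+1 + 1).+1).+1 by lia.
    rewrite -kpowD// -[in P (_ + 1).+1]kpowD//.
    transitivity (int2 mu (fun s u => (L ^+ k.+3)^-1 * (P 1 x s * (P (k + k).+1 s u * P 1 u y)))).
      rewrite int2Z; last first.
        apply: bmf2M; first exact: (bmf2_fst _ (bmf2_l x (hP 1))).
        by apply: bmf2M; [exact: hP|exact: (bmf2_snd _ (bmf2_r y (hP 1)))].
      congr (_ * _); apply: eq_Rintegral => s _; rewrite /kmul integZ//.
      by apply: bmfM; [exact: (bmf2_l _ (hP _))|exact: (bmf2_r y (hP 1))].
    apply: eq_int2 => s u; have -> : k.+3 = (2 + k.+1)%N by [].
    by rewrite exprD invfM; ring.
  rewrite !NE -int2B; last 2 first.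
  - by apply: bmf2M => //; exact: bmf2Z.
  - by apply: bmf2M => //; exact: bmf2Z.
  have hNnm : bmf2 (fun s u => N n s u - N m s u) by exact: bmf2B.
  have := int2_CS mu (bmf2Z (L ^+ 2)^-1 hw) hNnm.
  under eq_int2 do rewrite mulrBr.
  move=> /le_trans; apply; apply: ler_pM.
  - by apply: int2_ge0 => s u; exact: sqr_ge0.
  - by apply: int2_ge0 => s u; exact: sqr_ge0.
  - rewrite /D -int2_cst; apply: int2_le; [exact/bmf2_sqr/bmf2Z|exact: bmf2_cst|].
    move=> s u; rewrite -[leLHS]real_normK ?num_real// lerXn2r ?nnegrE//.
      by rewrite divr_ge0 ?sqr_ge0// mulr_ge0// ltW.
    have L2 : 0 <= (L ^+ 2)^-1 by rewrite invr_ge0 sqr_ge0.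
    rewrite normrM [leLHS]mulrC (ger0_norm L2); apply: (ler_wpM2r L2).
    by rewrite normrM; apply: ler_pM; [exact: normr_ge0..|exact: (hc (x, s))|exact: (hc (u, y))].
  have NN2 k : int2 mu (fun s u => N k s u ^+ 2) = a (k + k).+1 by rewrite -NN.
  by rewrite (int2_sqrB mu (hN n) (hN m)) !NN2 NN.
have Ncauchy e : 0 < e -> exists n0, forall n m, (n0 <= n)%N -> (n0 <= m)%N ->
    forall p : X * X, `|N n p.1 p.2 - N m p.1 p.2| <= e.
  (* If three terms of [a] are within [de] of the limit, their combination in [NC] is at most
     [4 * de]; [D + 1] avoids a division by zero. *)
  move=> e0; pose de := e ^+ 2 / (4 * (D + 1)).
  have D1 : 0 < D + 1 by rewrite ltr_wpDl.
  have de0 : 0 < de by rewrite divr_gt0 ?exprn_gt0// mulr_gt0.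
  have [n0 _ hn0] := (cvgrPdist_le _ _).1 ac de de0.
  exists n0.+2 => -[|[|n]]// [|[|m]]//; rewrite !ltnS => nn0 mn0 [x y] /=.
  rewrite -(@ler_pXn2r _ 2) ?nnegrE ?(ltW e0)// real_normK ?num_real//.
  apply: le_trans (NC n m x y) _.
  have h1 : `|limn a - a (n + n).+1| <= de.
    exact: (hn0 _ (leqW (leq_trans nn0 (leq_addr _ _)))).
  have h2 : `|limn a - a (n + m).+1| <= de.
    exact: (hn0 _ (leqW (leq_trans nn0 (leq_addr _ _)))).
  have h3 : `|limn a - a (m + m).+1| <= de.
    exact: (hn0 _ (leqW (leq_trans mn0 (leq_addr _ _)))).
  apply: (@le_trans _ _ (D * (4 * de))).
    apply: ler_wpM2l => //; move: h1 h2 h3; rewrite !ler_norml.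
    by move=> /andP[? ?] /andP[? ?] /andP[? ?]; lra.
  have -> : D * (4 * de) = e ^+ 2 * (D / (D + 1)).
    by rewrite /de; field; rewrite gt_eqF.
  rewrite -[leRHS]mulr1 ler_pM2l ?exprn_gt0// ler_pdivrMr// mul1r.
  by rewrite lerDl.
have [G bG hG] := uniform_cauchy_limit hN Ncauchy.
pose Q x y := G (x, y).
have hQ : bmf2 Q by move: bG; rewrite /bmf2; congr (bmf _); apply/funext => -[].
have QE x y : kmul mu (kmul mu M M) Q x y = L * Q x y.
  have NS n : kmul mu (P 1) (N n) x y = L * N n.+1 x y.
    rewrite /kmul; transitivity ((L ^+ n.+1)^-1 * kmul mu (P 1) (P (n + n).+1) x y).
      rewrite -integZ; last first.
        by apply: bmfM; [exact: (bmf2_l x (hP 1))|exact: (bmf2_r y (hP _))].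
      by apply: eq_Rintegral => s _; rewrite /N mulrCA.
    rewrite (kpowD mu hM) /N mulrA.
    have -> : (1 + (n + n).+1).+1 = (n.+1 + n.+1).+1 by rewrite add1n addSn addnS.
    by rewrite (exprS L n.+1) invfM mulrA divff ?mul1r// hL.
  rewrite -[kmul mu M M]/(P 1); apply: subr0_eq.
  apply: (@eq0_norm_le _ (kmul mu (P 1) Q x y - L * Q x y) (c * fine (mu setT) + L)).
    by rewrite addr_ge0 ?mulr_ge0 ?fine_ge0 ?(ltW c0) ?(ltW L0).
  move=> e e0; have [n0 hn0] := hG e e0.
  have -> : kmul mu (P 1) Q x y - L * Q x y =
    \int[mu]_s (P 1 x s * (Q s y - N n0 s y)) + L * (N n0.+1 x y - Q x y).
    have -> : \int[mu]_s (P 1 x s * (Q s y - N n0 s y)) =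
        kmul mu (P 1) Q x y - kmul mu (P 1) (N n0) x y.
      rewrite /kmul -integB; last 2 first.
      - by apply: bmfM; [exact: (bmf2_l x (hP 1))|exact: bmf2_r].
      - by apply: bmfM; [exact: (bmf2_l x (hP 1))|exact: (bmf2_r y (hN n0))].
      by apply: eq_Rintegral => s _; rewrite mulrBr.
    by rewrite NS; ring.
  rewrite (le_trans (ler_normD _ _))// mulrDl; apply: lerD.
    rewrite mulrAC; apply: integ_norm_le.
      apply: bmfM; first exact: (bmf2_l x (hP 1)).
      by apply: bmfB; [exact: bmf2_r|exact: (bmf2_r y (hN n0))].
    move=> s; rewrite normrM; apply: ler_pM; [exact: normr_ge0..|exact: (hc (x, s))|].
    by rewrite distrC; exact: (hn0 n0 (leqnn _) (s, y)).
  rewrite normrM (gtr0_norm L0) ler_pM2l//.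
  exact: (hn0 n0.+1 (leqnSn _) (x, y)).
(* The square norm of [N n] is at least 1 because of [tL]. A zero limit would make [|N n0|] at most
   [e] everywhere, with [e] chosen so that the square norm falls below 1. *)
have [y [x Qxy]] : exists y x, Q x y != 0.
  apply: contrapT => /forallNP Q0.
  have m0 : 0 <= fine (mu setT) by exact: fine_ge0.
  pose e := (fine (mu setT) + 1)^-1.
  have e0 : 0 < e by rewrite invr_gt0 ltr_wpDl.
  have [n0 hn0] := hG e e0.
  have : 1 <= int2 mu (fun x y => N n0 x y * N n0 x y).
    rewrite NN ler_pdivlMr; last exact: exprn_gt0.
    by rewrite mul1r; exact: tL.
  apply/negP; rewrite -ltNge.
  apply: (@le_lt_trans _ _ (e ^+ 2 * fine (mu setT) ^+ 2)).
    rewrite -int2_cst; apply: int2_le; [exact: bmf2M|exact: bmf2_cst|move=> x y].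
    rewrite -expr2 -[leLHS]real_normK ?num_real// lerXn2r ?nnegrE ?(ltW e0)//.
    have := hn0 n0 (leqnn _) (x, y); have /forallNP/(_ x)/negP := Q0 y.
    by rewrite negbK /Q => /eqP ->; rewrite subr0.
  rewrite -exprMn expr_lt1//; last by rewrite mulr_ge0// ltW.
  by rewrite /e mulrC ltr_pdivrMr ?ltr_wpDl// mul1r ltrDl.
exists (Q^~ y); split; first exact: bmf2_r.
  by move=> z; exact: QE.
by exists x.
Qed.

End power_method.

(** * Eigenspaces and invariant kernels *)

Lemma integ_preserving (R : realType) d (X : measurableType d)
    (mu : {finite_measure set X -> \bar R}) (T : X -> X) (f : X -> R) :
  measure_preserving mu T -> bmf f -> \int[mu]_x f (T x) = \int[mu]_x f x.
Proof.
move=> [mT hT] hf; rewrite /Rintegral; congr fine.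
transitivity (\int[pushforward mu T]_x (f x)%:E)%E.
  rewrite (@integral_pushforward _ _ _ _ _ _ mT mu setT (EFin \o f))//.
  - by apply/measurable_EFinP; exact: hf.1.
  - by rewrite preimage_setT; apply: bmf_integrable; exact: bmf_comp mT hf.
by apply: eq_measure_integral => A mA _; exact: hT.
Qed.

Section eigenspace.
Context (R : realType) d (X : measurableType d) (mu : {finite_measure set X -> \bar R}).
Context (W : X -> X -> R) (hW : bmf2 W) (L : R) (L0 : 0 < L).
Local Notation I f := (\int[mu]_x f x).

(** The equation is required at every point, so a member of zero norm vanishes identically and not
    just almost everywhere. *)
Definition eigenspace_of (f : X -> R) :=
  bmf f /\ forall x, \int[mu]_y (W x y * f y) = L * f x.

Local Notation V := eigenspace_of.

Definition orthonormal_family (f : nat -> X -> R) m :=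
  forall i j, (i < m)%N -> (j < m)%N ->
    \int[mu]_x (f i x * f j x) = (i == j)%:R.

Lemma eigenspaceZ c f : V f -> V (fun x => c * f x).
Proof.
move=> [hf Wf]; split; first exact: bmfZ.
move=> x; under eq_Rintegral do rewrite mulrCA.
rewrite integZ; last by apply: bmfM => //; exact: bmf2_l.
by rewrite Wf mulrCA.
Qed.

Lemma eigenspaceB f g : V f -> V g -> V (fun x => f x - g x).
Proof.
move=> [hf Wf] [hg Wg]; split; first exact: bmfB.
move=> x; under eq_Rintegral do rewrite mulrBr.
rewrite integB; [|by apply: bmfM => //; exact: bmf2_l..].
by rewrite Wf Wg mulrBr.
Qed.

Lemma eigenspace_sum m (F : 'I_m -> X -> R) : (forall i, V (F i)) ->
  V (fun x => \sum_i F i x).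
Proof.
move=> hF; split; first by apply: bmf_sum => j; exact: (hF j).1.
move=> x; under eq_Rintegral do rewrite mulr_sumr.
rewrite integ_sum; last by move=> j; apply: bmfM; [exact: bmf2_l|exact: (hF j).1].
by rewrite mulr_sumr; apply: eq_bigr => i _; exact: (hF i).2.
Qed.

Lemma eigenspace_eq0 f : V f -> I (fun x => f x ^+ 2) = 0 -> forall x, f x = 0.
Proof.
move=> [hf Wf] f0 x; have := integ_CS mu (bmf2_l x hW) hf.
rewrite f0 mulr0 Wf => h; apply/eqP.
have /eqP : (L * f x) ^+ 2 = 0 by apply/eqP; rewrite eq_le h sqr_ge0.
by rewrite sqrf_eq0 mulf_eq0 gt_eqF.
Qed.

Lemma integ_basis_coord (f : nat -> X -> R) m (i : 'I_m) (c : nat -> R) :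
  (forall i, bmf (f i)) -> orthonormal_family f m ->
  I (fun x => f i x * \sum_(j < m) c j * f j x) = c i.
Proof.
move=> hf of_; under eq_Rintegral do rewrite mulr_sumr.
rewrite integ_sum; last by move=> j; apply: bmfM => //; exact: bmfZ.
rewrite (bigD1 i)//= big1 ?addr0.
  under eq_Rintegral do rewrite mulrCA.
  by rewrite integZ ?of_ ?eqxx ?mulr1//; exact: bmfM.
move=> j ji; under eq_Rintegral do rewrite mulrCA.
rewrite integZ ?of_//; last exact: bmfM.
by move: ji; rewrite eq_sym -val_eqE /= => /negbTE ->; rewrite mulr0.
Qed.

(** Pythagoras for the orthogonal projection of [g] onto the span of the family. *)
Lemma integ_residual_sqr (f : nat -> X -> R) m g :
  (forall i, bmf (f i)) -> orthonormal_family f m -> bmf g ->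
  I (fun x => (g x - \sum_(i < m) I (fun y => g y * f i y) * f i x) ^+ 2) =
  I (fun x => g x ^+ 2) - \sum_(i < m) (I (fun y => g y * f i y)) ^+ 2.
Proof.
move=> hf of_ hg; pose c i := I (fun y => g y * f i y).
pose p x := \sum_(i < m) c i * f i x.
have hp : bmf p by apply: bmf_sum => i; exact: bmfZ.
have gp : I (fun x => g x * p x) = \sum_(i < m) c i ^+ 2.
  under eq_Rintegral do rewrite /p mulr_sumr.
  rewrite integ_sum; last by move=> i; apply: bmfM => //; exact: bmfZ.
  apply: eq_bigr => i _; under eq_Rintegral do rewrite mulrCA.
  by rewrite integZ ?expr2//; exact: bmfM.
have fp (i : 'I_m) : I (fun x => f i x * p x) = c i.
  exact: integ_basis_coord.
have pp : I (fun x => p x * p x) = \sum_(i < m) c i ^+ 2.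
  under eq_Rintegral do rewrite {1}/p mulr_suml.
  rewrite integ_sum; last by move=> j; apply: bmfM => //; exact: bmfZ.
  apply: eq_bigr => i _; under eq_Rintegral do rewrite -mulrA.
  by rewrite integZ ?fp ?expr2//; exact: bmfM.
transitivity (I (fun x => g x ^+ 2 - 2 * (g x * p x) + p x * p x)).
  by apply: eq_Rintegral => x _; rewrite /p /c; ring.
rewrite integD; last 2 first.
- by apply: bmfB; [exact: bmfM|apply: bmfZ; exact: bmfM].
- exact: bmfM.
rewrite integB; [|exact: bmfM|by apply: bmfZ; exact: bmfM].
by rewrite integZ ?gp ?pp; [ring|exact: bmfM].
Qed.

(* Bessel's inequality for the sections of [W], integrated. *)
Lemma orthonormal_eigenspace_bound (f : nat -> X -> R) m :
  (forall i, V (f i)) -> orthonormal_family f m ->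
  m%:R * L ^+ 2 <= int2 mu (fun x y => W x y ^+ 2).
Proof.
move=> hf of_; have bf i := (hf i).1.
have -> : m%:R * L ^+ 2 = I (fun x => \sum_(i < m) (L * f i x) ^+ 2).
  rewrite integ_sum; last by move=> i; apply: bmfM; exact: bmfZ.
  rewrite (eq_bigr (fun=> L ^+ 2)); last first.
    move=> i _; under eq_Rintegral do rewrite exprMn.
    rewrite integZ; last exact: bmfM.
    by under eq_Rintegral do rewrite expr2; rewrite of_// eqxx mulr1.
  by rewrite sumr_const card_ord mulr_natl.
apply: integ_le.
- by apply: bmf_sum => i; apply: bmfM; exact: bmfZ.
- exact: (bmf_int mu (bmf2_sqr hW)).
move=> x; rewrite -subr_ge0.
have -> : \sum_(i < m) (L * f i x) ^+ 2 =
    \sum_(i < m) (I (fun y => W x y * f i y)) ^+ 2.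
  by apply: eq_bigr => i _; rewrite (hf i).2.
rewrite -integ_residual_sqr//; last exact: bmf2_l.
by apply: integ_ge0 => y; exact: sqr_ge0.
Qed.

(** Bessel's bound gives orthonormal families a maximal size. The residual of [g] along a maximal
    family must vanish, as it could otherwise be normalised and adjoined. *)
Lemma eigenspace_basis : (exists2 f, V f & exists x, f x != 0) ->
  exists m (f : nat -> X -> R), [/\ forall i, V (f i), orthonormal_family f m.+1 &
    forall g, V g -> forall x, g x = \sum_(i < m.+1) I (fun y => g y * f i y) * f i x].
Proof.
move=> [f0 Vf0 [x0 f0x0]].
pose normalize (h : X -> R) x := (Num.sqrt (I (fun x => h x ^+ 2)))^-1 * h x.
have Vn h : V h -> V (normalize h) by exact: eigenspaceZ.
have norm1 h : V h -> (exists x, h x != 0) ->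
    I (fun x => normalize h x * normalize h x) = 1.
  move=> Vh [x hx]; have bh := Vh.1.
  have h0 : I (fun x => h x ^+ 2) != 0.
    by apply: contra hx => /eqP /(eigenspace_eq0 Vh) ->.
  have hge0 : 0 <= I (fun x => h x ^+ 2) by apply: integ_ge0 => y; exact: sqr_ge0.
  transitivity (I (fun y => (I (fun x => h x ^+ 2))^-1 * h y ^+ 2)).
    apply: eq_Rintegral => y _; rewrite /normalize mulrACA -invfM -expr2 sqr_sqrtr//.
  by rewrite integZ ?mulVf//; exact: bmfM.
pose Q m := `[< exists2 f : nat -> X -> R, forall i, V (f i) & orthonormal_family f m.+1 >].
have Q0 : exists m, Q m.
  exists 0; apply/asboolP; exists (fun=> normalize f0); first by move=> i; exact: Vn.
  move=> [|i] [|j]// _ _; rewrite eqxx; apply: norm1 => //; by exists x0.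
have Qb m : Q m -> (m <= Num.bound (int2 mu (fun x y => W x y ^+ 2) / L ^+ 2))%N.
  move=> /asboolP[f Vf of_]; have := orthonormal_eigenspace_bound Vf of_.
  rewrite -ler_pdivlMr ?exprn_gt0// => h; apply: ltnW; rewrite -(ltr_nat R).
  apply: lt_trans (le_lt_trans h (archi_boundP _)); first by rewrite ltr_nat.
  rewrite divr_ge0 ?sqr_ge0//; apply: int2_ge0 => x y; exact: sqr_ge0.
have [m /asboolP[f Vf of_] mmax] := ex_maxnP Q0 Qb.
exists m, f; split => // g Vg x; apply/eqP; rewrite -subr_eq0; apply/eqP.
pose p x := \sum_(i < m.+1) I (fun y => g y * f i y) * f i x.
have Vh : V (fun x => g x - p x).
  by apply: eigenspaceB => //; apply: eigenspace_sum => i; exact: eigenspaceZ.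
apply: contrapT => /eqP hx; suff /mmax : Q m.+1 by rewrite ltnn.
apply/asboolP; pose h := normalize (fun x => g x - p x).
exists (fun i => if i == m.+1 then h else f i).
  by move=> i; case: ifP => // _; exact: Vn.
have bf i := (Vf i).1.
have fh i : (i < m.+1)%N -> I (fun x => f i x * h x) = 0.
  move=> im; transitivity ((Num.sqrt (I (fun x => (g x - p x) ^+ 2)))^-1 *
      I (fun x => f i x * (g x - p x))).
    rewrite -integZ; last by apply: bmfM => //; exact: Vh.1.
    by apply: eq_Rintegral => y _; rewrite /h /normalize mulrCA.
  suff -> : I (fun x => f i x * (g x - p x)) = 0 by rewrite mulr0.
  under eq_Rintegral do rewrite mulrBr.
  rewrite integB; last 2 first.
  - by apply: bmfM => //; exact: Vg.1.
  - apply: bmfM => //; apply: bmf_sum => j; exact: bmfZ.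
  rewrite [X in _ - X](_ : _ = I (fun y => g y * f i y)); last first.
    exact: (integ_basis_coord (Ordinal im) (fun i => I (fun y => g y * f i y)) bf of_).
  under eq_Rintegral do rewrite mulrC.
  by rewrite subrr.
move=> i j; rewrite ltnS leq_eqVlt => im; rewrite ltnS leq_eqVlt => jm.
case/orP: im => [/eqP->|im]; case/orP: jm => [/eqP->|jm].
- by rewrite eqxx; apply: norm1 => //; exists x.
- rewrite eqxx (ltn_eqF jm) gtn_eqF//; under eq_Rintegral do rewrite mulrC.
  exact: fh.
- by rewrite eqxx (ltn_eqF im) fh.
- by rewrite (ltn_eqF im) (ltn_eqF jm) of_.
Qed.

End eigenspace.

Lemma complex_sumE (R : realType) (J : Type) (s : seq J) (v : J -> R[i]) (c : J -> R) :
  \sum_(j <- s) v j * (c j)%:C%C =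
  Complex (\sum_(j <- s) complex.Re (v j) * c j) (\sum_(j <- s) complex.Im (v j) * c j).
Proof.
elim: s => [|j s IH]; first by rewrite !big_nil.
rewrite !big_cons IH; case: (v j) => a b /=.
by apply/eqP; rewrite eq_complex /= !mulr0 subr0 add0r !eqxx.
Qed.

Lemma ess_sup_normc_lt (R : realType) d (X : measurableType d)
    (mu : {measure set X -> \bar R}) (f g : X -> R) : bmf f -> bmf g ->
  (ess_sup mu (fun x => (Normc.normc (Complex (f x) (g x)))%:E) < +oo)%E.
Proof.
move=> /bmf_bound[M M0 hM] /bmf_bound[N N0 hN].
apply: (@le_lt_trans _ _ (M + N)%:E); last exact: ltry.
apply/ess_supP; apply: aeW => x; rewrite lee_fin /=.
apply: (@le_trans _ _ (`|f x| + `|g x|)); last by rewrite lerD.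
have fg0 : 0 <= `|f x| + `|g x| by rewrite addr_ge0.
rewrite -(ger0_norm fg0) -sqrtr_sqr ler_wsqrtr//.
rewrite -(real_normK (num_real (f x))) -(real_normK (num_real (g x))) sqrrD.
by rewrite lerD2r lerDl mulrn_wge0// mulr_ge0.
Qed.

(** * Eigenspaces of a kernel invariant under the dynamics *)

Section invariant_kernel.
Context (R : realType) d (X : measurableType d) (mu : {finite_measure set X -> \bar R}).
Context (T : X -> X) (T_preserving : measure_preserving mu T).
Context (W : X -> X -> R) (hW : bmf2 W) (L : R) (L0 : 0 < L).
Hypothesis W_inv : forall x y, W (T x) (T y) = W x y.
Hypothesis W_mean0 : forall y, \int[mu]_x W x y = 0.
Local Notation V := (eigenspace_of mu W L).

(** Invariance replaces [W x y] by [W (T x) (T y)], and preservation of the measure then removes [T]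
    from the variable [y]. *)
Lemma eigenspace_comp f : V f -> V (f \o T).
Proof.
move=> [hf Wf]; split; first exact: bmf_comp T_preserving.1 hf.
move=> x; transitivity (\int[mu]_y (W (T x) y * f y)); last exact: Wf.
rewrite -[RHS](integ_preserving T_preserving).
  by apply: eq_Rintegral => y _; rewrite W_inv.
by apply: bmfM => //; exact: bmf2_l.
Qed.

(** [L] times the mean of [f] is the double integral of [W x y * f y]; integrating in [x] first
    gives zero. *)
Lemma eigenspace_mean0 f : V f -> \int[mu]_x f x = 0.
Proof.
move=> [hf Wf]; apply/eqP; rewrite -(mulrI_eq0 _ (mulfI (lt0r_neq0 L0))) -integZ//.
under eq_Rintegral do rewrite -Wf.
rewrite integ_fubini; last by apply: bmf2M => //; exact: bmf2_snd.
rewrite (@eq_Rintegral _ _ _ _ _ (fun=> 0)) ?integ_cst ?mul0r// => y _.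
by rewrite integZr ?W_mean0 ?mul0r//; exact: bmf2_r.
Qed.

(** Composition with [T] acts on the finite-dimensional eigenspace and has an eigenvector there over
    the complex numbers. Weak mixing makes this function constant, zero mean makes the constant
    zero, and orthonormality then makes all its coordinates zero. *)
Lemma weakly_mixing_eigenspace : weakly_mixing mu T -> mu setT <> 0%E ->
  ~ exists2 f, V f & exists x, f x != 0.
Proof.
move=> wm mu0 /(eigenspace_basis hW L0)[m [f [Vf of_ fbasis]]].
have mupos : fine (mu setT) != 0 by rewrite fine_eq0 ?fin_num_measure//; apply/eqP.
have bf i := (Vf i).1.
(* Row [i] holds the coordinates of [f i \o T], so a left eigenvector of [A] gives the coordinates
   of an eigenfunction. *)
pose A : 'M[R[i]]_m.+1 := \matrix_(i, j) (\int[mu]_y (f i (T y) * f j y))%:C%C.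
have [a] : exists a, eigenvalue A a.
  have /closed_rootP [a rAa] : size (char_poly A) != 1%N by rewrite size_char_poly.
  by exists a; rewrite eigenvalue_root_char.
move=> /eigenvalueP[v vA v0].
pose re x := \sum_(j < m.+1) complex.Re (v 0 j) * f j x.
pose im x := \sum_(j < m.+1) complex.Im (v 0 j) * f j x.
have bre : bmf re by apply: bmf_sum => j; exact: bmfZ.
have bim : bmf im by apply: bmf_sum => j; exact: bmfZ.
pose F x := Complex (re x) (im x).
have FE x : F x = \sum_j v 0 j * (f j x)%:C%C by rewrite complex_sumE.
have FT x : F (T x) = a * F x.
  rewrite !FE mulr_sumr; under eq_bigr => i _.
    rewrite [f i (T x)](fbasis (f i \o T)); last exact: eigenspace_comp.
    rewrite rmorph_sum mulr_sumr; over.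
  rewrite exchange_big /=; apply: eq_bigr => j _.
  have : (v *m A) 0 j = (a *: v) 0 j by rewrite vA.
  rewrite !mxE => e; rewrite mulrA -e mulr_suml; apply: eq_bigr => i _.
  by rewrite mxE rmorphM mulrA.
have [c Fc] : exists c, {ae mu, forall x, F x = c}.
  apply: (wm F a); last by apply: aeW => x; exact: FT.
  by split; [exact: bre.1|exact: bim.1|exact: ess_sup_normc_lt].
have zero (g : X -> R) (k : R) (w : 'I_m.+1 -> R) :
    (forall x, g x = \sum_j w j * f j x) -> {ae mu, forall x, g x = k} -> forall j, w j = 0.
  move=> gE gk j; have bg : bmf g.
    by rewrite (_ : g = fun x => \sum_j w j * f j x);
      [apply: bmf_sum => i; exact: bmfZ|exact/funext].
  have g0 : \int[mu]_x g x = 0.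
    under eq_Rintegral do rewrite gE.
    rewrite integ_sum; last by move=> i; exact: bmfZ.
    by rewrite big1// => i _; rewrite integZ// eigenspace_mean0// mulr0.
  have k0 : k = 0.
    move: g0; rewrite (eq_integ_ae bg (bmf_cst X k) gk) integ_cst => /eqP.
    by rewrite mulf_eq0 (negbTE mupos) orbF => /eqP.
  have : \int[mu]_x (f j x * g x) = 0.
    rewrite (@eq_integ_ae _ _ _ mu _ (fun=> 0)) ?integ_cst ?mul0r//.
    - exact: bmfM.
    - exact: bmf_cst.
    - by apply: filterS gk => x ->; rewrite k0 mulr0.
  under eq_Rintegral do rewrite gE.
  pose w' (n : nat) := w (inord n).
  have := integ_basis_coord j w' bf of_.
  under eq_Rintegral do under eq_bigr do rewrite /w' inord_val.
  by rewrite /w' inord_val => -> .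
have vre := zero re (complex.Re c) _ (fun=> erefl).
have vim := zero im (complex.Im c) _ (fun=> erefl).
move/eqP: v0; apply; apply/rowP => j; rewrite mxE.
apply/eqP; rewrite eq_complex /=; apply/andP; split; apply/eqP.
- by apply: vre; apply: filterS Fc => x <-.
- by apply: vim; apply: filterS Fc => x <-.
Qed.

End invariant_kernel.

(** * Ergodicity of the product *)

Lemma integ_eq0_ae_ge0 (R : realType) d (X : measurableType d)
    (mu : {finite_measure set X -> \bar R}) (f : X -> R) :
  bmf f -> {ae mu, forall x, 0 <= f x} -> \int[mu]_x f x = 0 ->
  {ae mu, forall x, f x = 0}.
Proof.
move=> hf f0 If.
have [M M0 hM] := bmf_bound hf.
have hn : bmf (fun x => `|f x|).
  split; first by apply: measurableT_comp => //; exact: hf.1.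
  by exists M => x; rewrite normr_id.
have nf : {ae mu, forall x, `|f x| = f x} by apply: filterS f0 => x /ger0_norm.
have /(integ_eq0_ae hn) : \int[mu]_x `|f x| = 0 by rewrite (eq_integ_ae hn hf nf).
by move=> h; apply: filterS (h _) => // x /eqP; rewrite normr_eq0 => /eqP.
Qed.

Section almost_everywhere.
Context (R : realType) d (X : measurableType d) (mu : {measure set X -> \bar R}).

Lemma measure0_ae_notin (A : set X) : measurable A -> mu A = 0%E ->
  {ae mu, forall x, ~ A x}.
Proof.
move=> mA A0; apply: (negligibleS _ ((negligibleP mu mA).2 A0)).
by move=> x /= /contrapT.
Qed.

Lemma ae_exists (P : X -> Prop) : mu setT <> 0%E -> {ae mu, forall x, P x} -> exists x, P x.
Proof.
move=> mu0 [N [mN N0 PN]]; apply: contrapT => /forallNP h; apply: mu0.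
apply/eqP; rewrite eq_le measure_ge0 andbT -N0 le_measure ?inE//.
by move=> x _; apply: PN; exact: h.
Qed.

End almost_everywhere.

Section ergodic_mean.
Context (R : realType) d (X : measurableType d) (mu : {finite_measure set X -> \bar R}).
Context (T : X -> X).

(** The set where [f] is positive is invariant, hence null or conull: [f] has one sign almost
    everywhere, and its mean is zero. *)
Lemma ergodic_invariant_mean0 f : ergodic mu T -> bmf f -> (forall x, f (T x) = f x) ->
  \int[mu]_x f x = 0 -> {ae mu, forall x, f x = 0}.
Proof.
move=> T_erg hf fT f0.
have mE : measurable [set x | 0 < f x] by apply: measurable_set_gt; exact: hf.1.
have invE : T @^-1` [set x | 0 < f x] = [set x | 0 < f x].
  by apply/seteqP; split => x /=; rewrite fT.
have [h|h] := T_erg _ mE invE.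
- have hN : bmf (fun x => -1 * f x) by exact: bmfZ.
  have : {ae mu, forall x, -1 * f x = 0}.
    apply: integ_eq0_ae_ge0 => //; last by rewrite integZ// f0 mulr0.
    apply: filterS (measure0_ae_notin mE h) => x /= /negP.
    by rewrite -leNgt mulN1r oppr_ge0.
  by apply: filterS => x /eqP; rewrite mulN1r oppr_eq0 => /eqP.
- apply: integ_eq0_ae_ge0 => //.
  apply: filterS (measure0_ae_notin (measurableC mE) h) => x /= /contrapT.
  exact: ltW.
Qed.

End ergodic_mean.

Definition pair_map (X : Type) (T : X -> X) (p : X * X) := (T p.1, T p.2).

Section product_ergodic.
Context (R : realType) d (X : measurableType d) (mu : {finite_measure set X -> \bar R}).
Context (T : X -> X) (T_preserving : measure_preserving mu T) (T_ergodic : ergodic mu T).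
Hypothesis mu_neq0 : mu setT <> 0%E.
Local Notation mu2 := (mu \x mu)%E.
Local Notation m := (fine (mu setT)).

Lemma mass_gt0 : 0 < m.
Proof.
rewrite lt_neqAle fine_ge0// andbT eq_sym fine_eq0 ?fin_num_measure//.
exact/eqP.
Qed.

Lemma prod_mass : mu2 setT = (m ^+ 2)%:E.
Proof.
by rewrite -setXTT product_measure1E// expr2 EFinM fineK// fin_num_measure.
Qed.

Lemma weakly_mixing_product_ergodic (E : set (X * X)) : weakly_mixing mu T ->
  measurable E -> pair_map T @^-1` E = E -> mu2 E = 0%E \/ mu2 (~` E) = 0%E.
Proof.
move=> wm mE invE; have m0 := mass_gt0.
pose b := fine (mu2 E) / m ^+ 2.
pose K x y : R := \1_E (x, y) - b.
have hE := bmf2_indic R mE.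
have hK : bmf2 K by apply: bmf2B => //; exact: bmf2_cst.
have bm : b * m ^+ 2 = fine (mu2 E) by rewrite divfK// gt_eqF// exprn_gt0.
have ET x y : \1_E (T x, T y) = \1_E (x, y) :> R.
  rewrite !indicE; congr ((nat_of_bool _)%:R); rewrite -[in RHS]invE.
  by apply/idP/idP; rewrite !inE.
have KT x y : K (T x) (T y) = K x y by rewrite /K ET.
have JK : int2 mu K = 0.
  rewrite (int2B mu hE (bmf2_cst _ _ b)) int2_indic// int2_cst bm subrr //.
(* The mean of [K] over its first variable is an invariant function of the second, with total
   integral zero. *)
have k0 : {ae mu, forall u, \int[mu]_x K x u = 0}.
  apply: (ergodic_invariant_mean0 T_ergodic).
  - exact: (bmf_int mu (bmf2_swap hK)).
  - move=> u; rewrite -[LHS](integ_preserving T_preserving); last exact: bmf2_r.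
    by apply: eq_Rintegral => x _; exact: KT.
  - by rewrite -integ_fubini.
pose M := kmul mu K (fun s z => K z s).
have hM : bmf2 M by apply: bmf2_kmul => //; exact: bmf2_swap.
have M_sym x y : M x y = M y x by apply: eq_Rintegral => s _; rewrite mulrC.
have MT x y : M (T x) (T y) = M x y.
  rewrite /M /kmul -[LHS](integ_preserving T_preserving); last first.
    by apply: bmfM; exact: bmf2_l.
  by apply: eq_Rintegral => s _; rewrite !KT.
(* This holds for every [s], because the exceptional null set of [k0] is integrated out. *)
have M_mean s : \int[mu]_x M x s = 0.
  rewrite integ_fubini; last first.
    by apply: bmf2M => //; exact: (bmf2_snd _ (bmf2_l s hK)).
  rewrite (@eq_integ_ae _ _ _ mu _ (fun=> 0)) ?integ_cst ?mul0r//.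
  - apply: (bmf_int mu (K := fun y x => K x y * K s y)).
    by apply: bmf2M; [exact: bmf2_swap|exact: (bmf2_fst _ (bmf2_l s hK))].
  - exact: bmf_cst.
  by apply: filterS k0 => u hu; rewrite integZr ?hu ?mul0r//; exact: bmf2_r.
(* [sym_kernel_eigenfunction] yields an eigenfunction of the square of its kernel, so invariance and
   zero means are transferred from [M] to [W]. *)
pose W := kmul mu M M.
have hW : bmf2 W by exact: bmf2_kmul.
have WT x y : W (T x) (T y) = W x y.
  rewrite /W /kmul -[LHS](integ_preserving T_preserving); last first.
    by apply: bmfM; [exact: bmf2_l|exact: bmf2_r].
  by apply: eq_Rintegral => s _; rewrite !MT.
have W_mean y : \int[mu]_x W x y = 0.
  rewrite integ_fubini; last first.
    by apply: bmf2M => //; exact: (bmf2_snd _ (bmf2_r y hM)).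
  rewrite (@eq_Rintegral _ _ _ _ _ (fun=> 0)) ?integ_cst ?mul0r// => s _.
  by rewrite integZr ?M_mean ?mul0r//; exact: bmf2_r.
have K20 : int2 mu (fun x y => K x y ^+ 2) = 0.
  apply: (kmul_adj_eq0 hK); apply: contrapT => /eqP M0.
  have Mpos : 0 < int2 mu (fun x y => M x y ^+ 2).
    rewrite lt_neqAle eq_sym M0; apply: int2_ge0 => x y; exact: sqr_ge0.
  have [L L0 [f [bf Wf fn0]]] := sym_kernel_eigenfunction hM M_sym Mpos.
  apply: (weakly_mixing_eigenspace T_preserving hW L0 WT W_mean wm mu_neq0).
  by exists f.
(* The integral of [K ^+ 2] equals [b * (1 - b) * m ^+ 2], so [E] has relative measure 0 or 1. *)
have : b * (1 - b) = 0.
  have : (1 - 2 * b) * fine (mu2 E) + b ^+ 2 * m ^+ 2 = 0.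
    rewrite -K20 -int2_indic// -int2_cst -int2Z// -int2D; [|exact: bmf2Z|exact: bmf2_cst].
    apply: eq_int2 => x y; rewrite /K indicE.
    by case: (_ \in E) => /=; ring.
  rewrite -bm => h; have : (b * (1 - b)) * m ^+ 2 = 0 by rewrite -h; ring.
  by move=> /eqP; rewrite mulf_eq0 sqrf_eq0 (gt_eqF m0) orbF => /eqP.
move=> /eqP; rewrite mulf_eq0 => /orP[/eqP b0|/eqP b1].
  left; move: bm; rewrite b0 mul0r => /esym/eqP.
  by rewrite fine_eq0 ?prod_fin_num// => /eqP.
right; have -> : mu2 (~` E) = (mu2 setT - mu2 E)%E.
  rewrite -setTD -[in RHS](setTI E); apply: measureD => //.
  by rewrite ltey_eq prod_fin_num.
rewrite prod_mass -(@fineK _ (mu2 E)) ?prod_fin_num// -bm.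
have -> : b = 1 by rewrite (subr0_eq b1).
by rewrite mul1r -EFinB subrr.
Qed.

End product_ergodic.

(** * Infinitely many visits and Li-Yorke pairs *)

Section recurrence.
Context (R : realType) d (X : measurableType d) (mu : {finite_measure set X -> \bar R}).
Context (T : X -> X) (T_preserving : measure_preserving mu T) (T_ergodic : ergodic mu T).
Hypothesis mu_neq0 : mu setT <> 0%E.
Hypothesis T_wm : weakly_mixing mu T.
Local Notation mu2 := (mu \x mu)%E.
Local Notation S := (pair_map T).

Lemma measurable_pair_map : measurable_fun setT S.
Proof.
apply: measurable_fun_pair; first exact: measurableT_comp T_preserving.1 measurable_fst.
exact: measurableT_comp T_preserving.1 measurable_snd.
Qed.

Lemma pair_map_preserving E : measurable E -> mu2 (S @^-1` E) = mu2 E.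
Proof.
move=> mE; have mSE : measurable (S @^-1` E).
  by rewrite -[X in measurable X]setTI; exact: measurable_pair_map.
have hE := bmf2_indic R mE.
rewrite -[LHS]fineK ?prod_fin_num// -[RHS]fineK ?prod_fin_num//; congr (_%:E).
rewrite -(int2_indic _ mE) -(int2_indic _ mSE) /int2.
rewrite -[RHS](integ_preserving T_preserving); last exact: bmf_int.
apply: eq_Rintegral => x _; rewrite -[RHS](integ_preserving T_preserving).
  by [].
exact: (bmf2_l (T x) hE).
Qed.

Lemma measurable_iter_pair_map n : measurable_fun setT (iter n S).
Proof.
by elim: n => [|n IH]; [exact: measurable_id|exact: measurableT_comp measurable_pair_map IH].
Qed.

Lemma measurable_iter_preimage n E : measurable E -> measurable (iter n S @^-1` E).
Proof.
by move=> mE; rewrite -[X in measurable X]setTI; exact: measurable_iter_pair_map.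
Qed.

Lemma iter_pair_map_preserving n E : measurable E -> mu2 (iter n S @^-1` E) = mu2 E.
Proof.
move=> mE; elim: n => [|n IH]; first by [].
rewrite -IH -(pair_map_preserving (measurable_iter_preimage n mE)).
by congr (mu2 _); apply/funext => p; rewrite /preimage /mkset iterSr.
Qed.

(** The limsup of the preimages of [E] is invariant. Each tail union contains a preimage, which has
    the measure of [E], so the limsup is not null; ergodicity of the product makes it conull. *)
Lemma infinitely_often_ae E : measurable E -> mu2 E <> 0%E ->
  {ae mu2, forall p, forall n, exists2 j, (n <= j)%N & E (iter j S p)}.
Proof.
move=> mE E0; pose F j := iter j S @^-1` E.
have mF j : measurable (F j) by exact: measurable_iter_preimage.
pose B := lim_sup_set F.
have mB : measurable B.
  apply: bigcapT_measurable => n; apply: bigcup_measurable => j _; exact: mF.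
have SB : S @^-1` B = B.
  apply/seteqP; split => p /= Bp n _.
    have [j /= nj Fj] := Bp n Logic.I; exists j.+1; first exact: leqW.
    by rewrite /F /preimage /mkset iterSr.
  (* Asking for an index of at least [n.+1] ensures that one application of the map can be
     removed. *)
  have [[//|j] /= nj Fj] := Bp n.+1 Logic.I; exists j; first by [].
  by move: Fj; rewrite /F /preimage /mkset iterSr.
have B0 : mu2 B <> 0%E.
  move=> B0; apply: E0; apply/eqP; rewrite eq_le measure_ge0 andbT -B0.
  apply: (cvge_to_ge (lim_sup_set_cvg mu2 F mF _)).
    by rewrite ltey_eq prod_fin_num//; apply: bigcup_measurable => j _; exact: mF.
  apply: nearW => n; rewrite -(iter_pair_map_preserving n mE).
  apply: le_measure; [by rewrite inE; exact: mF| |].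
    by rewrite inE; apply: bigcup_measurable => j _; exact: mF.
  by move=> p Fp; exists n => //=.
have [//|BC] := weakly_mixing_product_ergodic T_preserving T_ergodic mu_neq0 T_wm mB SB.
apply: filterS (measure0_ae_notin (measurableC mB) BC) => p /contrapT Bp n.
by have [j nj Fj] := Bp n Logic.I; exists j.
Qed.

Context (mu_nonatomic : nonatomic mu).
Context (dist : X -> X -> R) (dist_compat : compatible_metric mu dist).

Let bdist : borel_metric dist := dist_compat.1.

Lemma dist_xx x : dist x x = 0. Proof. exact/(bmetric_eq0 bdist). Qed.

Lemma bmf2_dist : bmf2 dist.
Proof.
split; first exact: bmetric_measurable bdist.
by exists 1 => p; rewrite ger0_norm ?(bmetric_ge0 bdist)// (bmetric_le1 bdist).
Qed.

Lemma prod_measure_eq0_ae E : measurable E -> mu2 E = 0%E ->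
  {ae mu, forall x, mu (xsection E x) = 0%E}.
Proof.
move=> mE E0; have hE := bmf2_indic R mE.
have : int2 mu (fun x y => \1_E (x, y)) = 0 by rewrite int2_indic// E0.
move=> /(integ_eq0_ae (bmf_int mu hE)) h; have {}h := h (fun x => integ_ge0 mu _).
apply: filterS (h _) => [x|x y]; last by rewrite indicE.
have mx : measurable (xsection E x) by exact: measurable_xsection.
rewrite (_ : (fun y => _) = \1_(xsection E x)); last first.
  by apply/funext => y; rewrite !indicE mem_xsection.
by rewrite integ_indic// => /eqP; rewrite fine_eq0 ?fin_num_measure// => /eqP.
Qed.

(** The sections of this set are balls around their base points, all of them non-null by
    compatibility. *)
Lemma prod_measure_close e : 0 < e -> mu2 [set p | dist p.1 p.2 < e] <> 0%E.
Proof.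
move=> e0 h; have mE : measurable [set p : X * X | dist p.1 p.2 < e].
  by apply: measurable_set_lt; exact: bmf2_dist.1.
have [x] := ae_exists mu_neq0 (prod_measure_eq0_ae mE h).
have -> : xsection [set p : X * X | dist p.1 p.2 < e] x = dball dist x e.
  by apply/seteqP; split => y; rewrite /xsection /= inE.
move=> /eqP; rewrite gt_eqF//; apply: dist_compat.2.
by exists x; rewrite /dball /= dist_xx.
Qed.

Lemma nonatomic_set1 x : measurable [set x] -> mu [set x] = 0%E.
Proof.
move=> mx; apply: contrapT => x0.
have pos : (0 < mu [set x])%E by rewrite lt_neqAle measure_ge0 andbT eq_sym; apply/eqP.
have [B [mB Bx B0 Blt]] := mu_nonatomic mx pos.
have [BE|BE] := subset_set1 Bx; first by rewrite BE measure0 ltxx in B0.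
by rewrite BE ltxx in Blt.
Qed.

(** Otherwise the distance vanishes almost everywhere; yet the diagonal is null, since its sections
    are singletons, which are measurable as sections and null by nonatomicity. *)
Lemma prod_measure_apart : exists2 e, 0 < e & mu2 [set p | e < dist p.1 p.2] <> 0%E.
Proof.
apply: contrapT => /forall2NP h.
have mlt (e : R) : measurable [set p : X * X | e < dist p.1 p.2].
  by apply: measurable_set_gt; exact: bmf2_dist.1.
have h1 n : {ae mu2, forall p, ~ n.+1%:R^-1 < dist p.1 p.2}.
  apply: (measure0_ae_notin (mlt n.+1%:R^-1)).
  by have [] := h n.+1%:R^-1 => // /contrapT.
have mD : measurable (~` [set p : X * X | 0 < dist p.1 p.2]) by exact: measurableC.
have sD x : xsection (~` [set p : X * X | 0 < dist p.1 p.2]) x = [set x].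
  apply/seteqP; split => y; rewrite /xsection /= inE /=.
    move/negP; rewrite -leNgt => dxy; apply/esym/(bmetric_eq0 bdist)/eqP.
    by rewrite eq_le dxy (bmetric_ge0 bdist).
  by move=> ->; rewrite dist_xx ltxx.
have D0 : mu2 (~` [set p : X * X | 0 < dist p.1 p.2]) = 0%E.
  rewrite -[LHS]fineK ?prod_fin_num// -int2_indic// /int2.
  rewrite (@eq_Rintegral _ _ _ _ _ (fun=> 0)) ?integ_cst ?mul0r// => x _.
  rewrite (_ : (fun y => _) = \1_[set x]); last first.
    by apply/funext => y; rewrite !indicE -mem_xsection sD.
  have mx : measurable [set x] by rewrite -(sD x); exact: measurable_xsection.
  by rewrite integ_indic// nonatomic_set1.
have h2 := measure0_ae_notin mD D0.
have m20 : mu2 setT <> 0%E.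
  by rewrite prod_mass => -[] /eqP; rewrite expf_eq0/= gt_eqF// mass_gt0.
have [p [hp1 hp2]] : exists p, (forall n, ~ n.+1%:R^-1 < dist p.1 p.2) /\ 0 < dist p.1 p.2.
  have [N [mN N0 hN]] : {ae mu2, forall p,
      (forall n, ~ n.+1%:R^-1 < dist p.1 p.2) /\ 0 < dist p.1 p.2}.
    have := ae_foralln h1; apply: filterS2 h2 => p hp2 hp1; split => //.
    by move: hp2 => /contrapT.
  apply: contrapT => /forallNP hn; apply: m20; apply/eqP.
  by rewrite eq_le measure_ge0 andbT -N0 le_measure ?inE// => p _; apply: hN; exact: hn.
pose n := Num.bound (dist p.1 p.2)^-1.
apply: (hp1 n); rewrite invf_plt ?posrE// (lt_trans (archi_boundP _)) ?ltr_nat//.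
by rewrite invr_ge0 ltW.
Qed.

Lemma iter_pair_map j p : iter j S p = (iter j T p.1, iter j T p.2).
Proof. by elim: j => [|j IH]; [case: p|rewrite !iterS IH]. Qed.

Lemma weakly_mixing_li_yorke_ae :
  {ae mu2, forall p, li_yorke_pair T dist p.1 p.2}.
Proof.
have [e e0 he] := prod_measure_apart.
have me : measurable [set p : X * X | e < dist p.1 p.2].
  by apply: measurable_set_gt; exact: bmf2_dist.1.
have far := infinitely_often_ae me he.
have near_ : {ae mu2, forall p, forall k n, exists2 j, (n <= j)%N &
    [set q : X * X | dist q.1 q.2 < k.+1%:R^-1] (iter j S p)}.
  apply: ae_foralln => k; apply: infinitely_often_ae.
    by apply: measurable_set_lt; exact: bmf2_dist.1.
  exact: prod_measure_close.
apply: filterS2 far near_ => p pfar pnear.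
pose u n : \bar R := (dist (iter n T p.1) (iter n T p.2))%:E.
split.
  rewrite limn_einf_lim -/u.
  suff -> : einfs u = fun=> 0%E by exact: lim_cst.
  apply/funext => n; apply/eqP; rewrite eq_le; apply/andP; split.
    apply/lee_addgt0Pr => r r0; rewrite add0e.
    have [j nj] := pnear (Num.bound r^-1) n.
    rewrite /= iter_pair_map /= => h.
    apply: (@le_trans _ _ (u j)).
      by apply: ereal_inf_lbound => /=; exists j.
    rewrite lee_fin ltW// (lt_trans h)// invf_plt ?posrE//.
    by rewrite (lt_trans (archi_boundP _)) ?ltr_nat// invr_ge0 ltW.
  apply: le_ereal_inf_tmp => _ [j _ <-]; rewrite lee_fin.
  exact: bmetric_ge0 bdist _ _.
rewrite limn_esup_lim -/u; apply: (@lt_le_trans _ _ e%:E); first by rewrite lte_fin.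
apply: lime_ge; first exact: is_cvg_esups.
apply: nearW => n; have [j nj] := pfar n; rewrite /= iter_pair_map /= => h.
apply: (@le_trans _ _ (u j)); first by rewrite lee_fin ltW.
by apply: ereal_sup_ubound => /=; exists j.
Qed.

End recurrence.

(** * A compatible metric adapted to two functions *)

Lemma standard_borel_separating (R : realType) d (X : measurableType d) :
  standard_borel R X -> exists A : nat -> set X, (forall i, measurable (A i)) /\
    forall x y, x <> y -> exists i, A i x /\ ~ A i y.
Proof.
move=> [P [f [hP [B Bc [Bo Bb]] fbij mE]]].
have /countable_injP[g ginj] := Bc.
(* The union has at most one member, [g] being injective, and is empty when no base set has number
   [i]. *)
pose U i := \bigcup_(V in [set V | B V /\ g V = i]) V.
have Uo i : open (U i) by apply: bigcup_open => V [BV _]; exact: Bo.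
exists (fun i => f @^-1` U i); split.
  move=> i; rewrite mE; exists (U i); last by rewrite setTI.
  exact: sub_sigma_algebra.
move=> x y xy; have fxy : f x != f y.
  by apply/eqP => /(bij_inj fbij).
move: hP; rewrite open_hausdorff => /(_ _ _ fxy)[[V W] /= [xV yW] [oV oW VW]].
have : nbhs (f x) V by apply: open_nbhs_nbhs; split => //; exact: set_mem.
move=> /Bb[V' [BV' V'x] V'V].
exists (g V'); split; first by exists V'.
move=> [V2 [BV2 gV2] V2y].
have eV : V2 = V' by apply: ginj => //; rewrite inE.
have : (V `&` W) (f y) by split; [apply: V'V; rewrite -eV|exact: set_mem].
by move/eqP: VW => ->.
Qed.

(** * An injective real-valued code from a separating sequence of sets *)

Section ternary_coding.
Context (R : realType) d (X : measurableType d) (A : nat -> set X).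
Hypothesis mA : forall i, measurable (A i).
Hypothesis sepA : forall x y, x <> y -> exists i, A i x /\ ~ A i y.

Let s n x : R := \sum_(i < n) 3^-1 ^+ i * \1_(A i) x.

Let sS n x : s n.+1 x = s n x + 3^-1 ^+ n * \1_(A n) x.
Proof. by rewrite /s big_ord_recr. Qed.

Let p3 n : 0 < (3^-1 : R) ^+ n. Proof. by rewrite exprn_gt0. Qed.

Let i01 (B : set X) x : \1_B x = 0 :> R \/ \1_B x = 1 :> R.
Proof. by rewrite indicE; case: (_ \in _); [right|left]. Qed.

Let s_nd x : nondecreasing_seq (s ^~ x).
Proof.
apply/nondecreasing_seqP => n; rewrite sS lerDl.
by case: (i01 (A n) x) => ->; rewrite ?mulr0 ?mulr1// ltW.
Qed.

Let s_le n x : s n x <= 2.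
Proof.
(* The stronger invariant reserves room for the whole remaining tail, [3^-1 ^+ n * (3 / 2)]. *)
suff : s n x + 3^-1 ^+ n * (3 / 2) <= 3 / 2 by have := p3 n; lra.
elim: n => [|n IH]; first by rewrite /s big_ord0 expr0 mul1r add0r.
rewrite sS exprS; have := p3 n.
by case: (i01 (A n) x) => ->; move: IH; lra.
Qed.

Let s_cvg x : cvgn (s ^~ x).
Proof. by apply: nondecreasing_is_cvgn => //; exists 2 => _ [n _ <-]. Qed.

(** At the first index [i] where membership differs, the term [3^-1 ^+ i] outweighs all later terms,
    whose sum is at most half of it. *)
Lemma injective_coding : exists phi : X -> R,
  [/\ measurable_fun setT phi, injective phi & forall x, 0 <= phi x <= 2].
Proof.
pose phi x := limn (s ^~ x); exists phi; split.
- apply: (@measurable_fun_cvg _ _ _ setT s) => [n|x _]; last exact: s_cvg.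
  apply: (bmf_sum _ _).1 => i; apply: bmfZ; exact: bmf_indic.
- suff lt_phi x y i : A i x -> ~ A i y ->
      (forall j, (j < i)%N -> \1_(A j) x = \1_(A j) y :> R) -> phi y < phi x.
    move=> x y xy; apply: contrapT => nxy.
    have exi : exists i, `[< A i x <> A i y >].
      have [i [Ax Ay]] := sepA nxy; exists i; apply/asboolP => e.
      by apply: Ay; rewrite -e.
    have [i /asboolP hi imin] := ex_minnP exi.
    have eqj j : (j < i)%N -> A j x = A j y.
      move=> ji; apply: contrapT => /asboolP/imin; by rewrite leqNgt ji.
    have [Ax|Ax] := pselect (A i x); have [Ay|Ay] := pselect (A i y).
    + by apply: hi; apply/propext.
    + have := lt_phi x y i Ax Ay; rewrite xy ltxx => /(_ _)/negP; apply => //.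
      by move=> j /eqj e; rewrite !indicE; congr ((nat_of_bool _)%:R); apply/idP/idP; rewrite !inE e.
    + have := lt_phi y x i Ay Ax; rewrite xy ltxx => /(_ _)/negP; apply => //.
      by move=> j /eqj e; rewrite !indicE; congr ((nat_of_bool _)%:R); apply/idP/idP; rewrite !inE e.
    + by apply: hi; apply/propext.
  move=> Ax Ay eqj.
  have si : s i x = s i y by apply: eq_bigr => j _; rewrite eqj.
  (* The second summand is the amount that the terms after [i + n] may still consume. *)
  have gap n : 3^-1 ^+ i / 2 + 3^-1 ^+ (i + n) / 2 <= s (i + n).+1 x - s (i + n).+1 y.
    elim: n => [|n IH].
      have -> : 3^-1 ^+ i / 2 + 3^-1 ^+ (i + 0) / 2 = 3^-1 ^+ i :> R.
        by rewrite addn0 -splitr.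
      rewrite addn0 !sS si !indicE mem_set// memNset// mulr0 mulr1 addr0.
      by rewrite addrC addKr.
    rewrite addnS [s (i + n).+2 x]sS [s (i + n).+2 y]sS exprS; have := p3 (i + n).
    move: IH; case: (i01 (A (i + n).+1) x) => ->; case: (i01 (A (i + n).+1) y) => ->; lra.
  have h : (fun n => s n x - s n y) @ \oo --> phi x - phi y.
    by apply: cvgB; exact: s_cvg.
  rewrite -subr_gt0; apply: (@lt_le_trans _ _ (3^-1 ^+ i / 2)); first by rewrite divr_gt0.
  apply: (cvgr_to_ge h); exists i.+1 => // n /= /subnKC <-.
  rewrite addSn; apply: le_trans (gap _); rewrite lerDl; have := p3 (i + (n - i.+1)); lra.
- move=> x; apply/andP; split.
    have := nondecreasing_cvgn_le (s_nd x) (@s_cvg x) 0%N.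
    by rewrite {1}/s big_ord0.
  by apply: (cvgr_to_le (@s_cvg x)); apply: nearW => n; exact: s_le.
Qed.

End ternary_coding.

(** * Disjoint non-null subsets of given non-null sets *)

Section disjoint_pieces.
Context (R : realType) d (X : measurableType d) (mu : {finite_measure set X -> \bar R}).
Hypothesis mu_nonatomic : nonatomic mu.
Local Notation nu A := (fine (mu A)).

Let muE (A : set X) : measurable A -> mu A = (nu A)%:E.
Proof. by move=> mA; rewrite fineK// fin_num_measure. Qed.

(** Of [B] and its complement in [C], both non-null by nonatomicity, one has at most half the
    measure of [C]; this halving is iterated. *)
Lemma nonatomic_small (A : set X) (e : R) : measurable A -> 0 < nu A -> 0 < e ->
  exists B, [/\ measurable B, B `<=` A, 0 < nu B & nu B <= e].
Proof.
move=> mA A0 e0.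
have half C : measurable C -> 0 < nu C ->
    exists B, [/\ measurable B, B `<=` C, 0 < nu B & nu B <= nu C / 2].
  move=> mC C0; have C0' : (0 < mu C)%E by rewrite muE// lte_fin.
  have [B [mB BC B0' BC']] := mu_nonatomic mC C0'.
  have B0 : 0 < nu B by rewrite -lte_fin -muE.
  have BltC : nu B < nu C by rewrite -lte_fin -!muE.
  have [h|h] := leP (nu B) (nu C / 2); first by exists B.
  have mD : measurable (C `\` B) by exact: measurableD.
  have nuD : nu (C `\` B) = nu C - nu B.
    by rewrite measureD ?(setIidr BC) ?fineB ?fin_num_measure// ltey_eq fin_num_measure.
  by exists (C `\` B); split => //; rewrite nuD; lra.
have pow n : exists B, [/\ measurable B, B `<=` A, 0 < nu B & nu B <= nu A / 2 ^+ n].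
  elim: n => [|n [B [mB BA B0 hB]]]; first by exists A; split; rewrite ?expr0 ?divr1.
  have [C [mC CB C0 hC]] := half B mB B0; exists C; split => //.
    exact: subset_trans BA.
  by apply: le_trans hC _; rewrite exprSr invfM mulrA ler_pM2r.
pose n := Num.bound (nu A / e).
have [B [mB BA B0 hB]] := pow n; exists B; split => //; apply: le_trans hB _.
rewrite ler_pdivrMr ?exprn_gt0// mulrC -ler_pdivrMr//.
apply: (@le_trans _ _ n%:R); first by rewrite ltW// archi_boundP// divr_ge0// ltW.
by rewrite -natrX ler_nat ltnW// ltn_expl.
Qed.

(** Inside [F n] a set [E n] is chosen with at most a quarter of the measure of its predecessor. All
    later sets together have at most half the measure of [E n], so removing them leaves a non-null
    piece. *)
Lemma disjoint_pieces (F : nat -> set X) :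
  (forall k, measurable (F k)) -> (forall k, 0 < nu (F k)) ->
  exists D : nat -> set X, [/\ forall k, measurable (D k), forall k, D k `<=` F k,
    forall k, 0 < nu (D k) & trivIset setT D].
Proof.
move=> mF F0.
have ex (Ae : set X * R) : exists B, measurable Ae.1 -> 0 < nu Ae.1 -> 0 < Ae.2 ->
    [/\ measurable B, B `<=` Ae.1, 0 < nu B & nu B <= Ae.2].
  have [[mA [A0 e0]]|h] := pselect (measurable Ae.1 /\ 0 < nu Ae.1 /\ 0 < Ae.2).
    by have [B hB] := nonatomic_small mA A0 e0; exists B.
  by exists Ae.1 => mA A0 e0; exfalso; apply: h.
have [pick hpick] := choice ex.
pose fix E n := if n is n'.+1 then pick (F n, nu (E n') / 4) else pick (F 0%N, 1).
have E_ n : [/\ measurable (E n), E n `<=` F n & 0 < nu (E n)].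
  elim: n => [|n [_ _ En0]].
    by have [] := hpick (F 0%N, 1) (mF _) (F0 _) ltr01.
  have e4 : 0 < nu (E n) / 4 by rewrite divr_gt0.
  by have [] := hpick (F n.+1, nu (E n) / 4) (mF _) (F0 _) e4.
have mE n : measurable (E n) by have [] := E_ n.
have E0 n : 0 < nu (E n) by have [] := E_ n.
have ES n : nu (E n.+1) <= nu (E n) / 4.
  have e4 : 0 < nu (E n) / 4 by rewrite divr_gt0.
  by have [] := hpick (F n.+1, nu (E n) / 4) (mF _) (F0 _) e4.
have Etail n k : nu (E (n + k.+1)%N) <= (nu (E n) / 2) / 2 ^+ k.+1.
  elim: k => [|k IH].
    by rewrite addn1 expr1; have := ES n; lra.
  rewrite addnS (le_trans (ES _))// [in leRHS]exprS invfM.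
  have := E0 (n + k.+1)%N.
  have -> : nu (E n) / 2 * (2^-1 / 2 ^+ k.+1) = (nu (E n) / 2 / 2 ^+ k.+1) / 2 by ring.
  by move: IH; lra.
pose U n := \bigcup_k E (n + k.+1)%N.
have mU n : measurable (U n) by exact: bigcupT_measurable.
exists (fun n => E n `\` U n); split.
- by move=> k; exact: measurableD.
- by move=> k x [Ex _]; have [_ EF _] := E_ k; exact: EF.
- move=> n; have UE : (mu (U n) <= (nu (E n) / 2)%:E)%E.
    have hsub := @measure_sigma_subadditive _ _ _ mu (U n) (fun k => E (n + k.+1)%N)
      (fun k => mE _) (mU n) (@subset_refl _ (U n)).
    apply: le_trans hsub _.
    apply: le_trans (epsilon_trick0 xpredT _); last by rewrite divr_ge0// ltW.
    apply: lee_nneseries => // k _.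
    have := Etail n k; rewrite -natrX -lee_fin -(muE (mE _)); exact.
  rewrite measureD//; last by rewrite ltey_eq fin_num_measure.
  have mEU : measurable (E n `&` U n) by exact: measurableI.
  rewrite fineB ?fin_num_measure// subr_gt0.
  apply: (@le_lt_trans _ _ (nu (E n) / 2)); last by have := E0 n; lra.
  rewrite -lee_fin -muE//; apply: le_trans UE; apply: le_measure; rewrite ?inE//.
- apply/trivIsetP => i j _ _; wlog ij : i j / (i < j)%N => [hw|_].
    rewrite neq_ltn => /orP[ij|ji]; first by apply: hw => //; rewrite neq_ltn ij.
    by rewrite setIC; apply: hw => //; rewrite neq_ltn ji.
  rewrite -subset0 => x [[_ nU] [Ej _]]; apply: nU; exists (j - i.+1)%N => //.
  by rewrite addnS -addSn subnKC.
Qed.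

End disjoint_pieces.

(** * Distances built from finitely many real functions *)

Section sum_distance.
Context (R : realType) d (X : measurableType d).
Implicit Types (h : X -> R) (hs : seq (X -> R)) (qs : seq rat).

Definition dsum hs x y := \sum_(h <- hs) `|h x - h y|.

(** An index past the end yields the constant 0, so only the members of [hs] are constrained. *)
Definition measurable_funs hs := forall i, measurable_fun setT (nth (fun=> 0) hs i).

Lemma measurable_funs_cons h hs : measurable_funs (h :: hs) ->
  measurable_fun setT h /\ measurable_funs hs.
Proof. by move=> mhs; split; [exact: mhs 0%N|move=> i; exact: mhs i.+1]. Qed.

Lemma dsum_cons h hs x y : dsum (h :: hs) x y = `|h x - h y| + dsum hs x y.
Proof. by rewrite /dsum big_cons. Qed.

Lemma dsum_nil x y : dsum [::] x y = 0.
Proof. by rewrite /dsum big_nil. Qed.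

Lemma dsum_ge0 hs x y : 0 <= dsum hs x y.
Proof. exact: sumr_ge0. Qed.

Lemma dsum_sym hs x y : dsum hs x y = dsum hs y x.
Proof. by apply: eq_bigr => h _; rewrite distrC. Qed.

Lemma dsum_xx hs x : dsum hs x x = 0.
Proof. by rewrite /dsum big1// => h _; rewrite subrr normr0. Qed.

Lemma dsum_triangle hs x y z : dsum hs x z <= dsum hs x y + dsum hs y z.
Proof. by rewrite /dsum -big_split; apply: ler_sum => h _; exact: ler_distD. Qed.

Lemma measurable_dsum hs : measurable_funs hs ->
  measurable_fun setT (fun p : X * X => dsum hs p.1 p.2).
Proof.
elim: hs => [|h hs IH] mhs.
  by under eq_fun do rewrite dsum_nil; exact: measurable_cst.
have [mh mhs'] := measurable_funs_cons mhs.
under eq_fun do rewrite dsum_cons.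
apply: measurable_funD; last exact: IH.
apply: measurableT_comp => //; apply: measurable_funB.
  exact: measurableT_comp mh measurable_fst.
exact: measurableT_comp mh measurable_snd.
Qed.

Lemma measurable_dsum_r hs x : measurable_funs hs -> measurable_fun setT (dsum hs x).
Proof.
by move=> /measurable_dsum m; exact: (measurableT_comp m (pair1_measurable x)).
Qed.

(** The l1 distance from the values of [hs] at [y] to a rational point. There are countably many
    such points, which [support_conull] exploits. *)
Definition qdist hs qs y := \sum_(p <- zip hs qs) `|p.1 y - ratr p.2|.

Lemma measurable_qdist hs qs : measurable_funs hs -> measurable_fun setT (qdist hs qs).
Proof.
rewrite /qdist; elim: hs qs => [|h hs IH] [|q qs] mhs /=;
  try by under eq_fun do rewrite big_nil; exact: measurable_cst.
have [mh mhs'] := measurable_funs_cons mhs.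
under eq_fun do rewrite big_cons /=.
apply: measurable_funD; last exact: IH.
by apply: measurableT_comp => //; apply: measurable_funB => //; exact: measurable_cst.
Qed.

Lemma qdist_approx hs x (e : R) : 0 < e ->
  exists2 qs, size qs = size hs & qdist hs qs x < e.
Proof.
elim: hs e => [|h hs IH] e e0; first by exists [::]; rewrite // /qdist big_nil.
have e2 : 0 < e / 2 by rewrite divr_gt0.
have [qs sqs hqs] := IH _ e2.
have [q qi] : exists q : rat, ratr q \in `]h x, h x + e / 2[%R.
  by apply: rat_in_itvoo; rewrite ltrDl.
exists (q :: qs); first by rewrite /= sqs.
move: hqs; rewrite /qdist /= big_cons /=; move: qi; rewrite in_itv /= => /andP[q1 q2].
by rewrite distrC gtr0_norm ?subr_gt0//; lra.
Qed.

Lemma dsum_qdist hs qs x y : size qs = size hs -> dsum hs x y <= qdist hs qs x + qdist hs qs y.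
Proof.
rewrite /qdist; elim: hs qs => [|h hs IH] [|q qs]//= => [_|[sqs]].
  by rewrite dsum_nil !big_nil addr0.
rewrite dsum_cons !big_cons /= addrACA lerD ?IH//.
by rewrite (le_trans (ler_distD (ratr q) _ _))// lerD2l distrC.
Qed.

Lemma borel_metric_dsum hs : measurable_funs hs ->
  (forall x y, dsum hs x y = 0 -> x = y) -> borel_metric (fun x y => Num.min 1 (dsum hs x y)).
Proof.
move=> mhs inj; split.
- by move=> x y; rewrite le_min ler01 dsum_ge0.
- by move=> x y; rewrite ge_min lexx.
- move=> x y; split; last by move=> ->; rewrite dsum_xx min_r.
  move=> h; apply: inj; move: h; rewrite /Num.min; case: ifP => // _ /eqP.
  by rewrite oner_eq0.
- by move=> x y; rewrite dsum_sym.
- move=> x y z; have := dsum_triangle hs x y z; have := dsum_ge0 hs x y.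
  have := dsum_ge0 hs y z; rewrite /Num.min.
  by case: ifP => h1; case: ifP => h2; case: ifP => h3; move: h1 h2 h3; rewrite ?ltNge; lra.
- by apply: measurable_minr; [exact: measurable_cst|exact: measurable_dsum].
Qed.

(** [N] is the union of the null sets among countably many rational boxes. If the trace on [D] of a
    ball around [x] were null, so would be a box inside it containing [x], and [x] would lie in
    [N]. *)
Lemma support_conull (mu : {measure set X -> \bar R}) hs (D : set X) :
  measurable_funs hs -> measurable D ->
  exists N, [/\ measurable N, N `<=` D, mu N = 0%E &
    forall x (r : R), D x -> ~ N x -> 0 < r ->
      (0 < mu (D `&` [set y | (dsum hs x y < r)%R]))%E].
Proof.
move=> mhs mD.
pose box (i : seq rat * nat) := D `&` [set y | qdist hs i.1 y < i.2.+1%:R^-1].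
have mbox i : measurable (box i).
  by apply: measurableI => //; apply: measurable_set_lt; exact: measurable_qdist.
pose F k := if unpickle k is Some i then if mu (box i) == 0%E then box i else set0 else set0.
have F0 k : measurable (F k) /\ mu (F k) = 0%E.
  rewrite /F; case: (unpickle k) => [i|]; last by rewrite measure0.
  by have [->|_] := eqVneq (mu (box i)) 0%E; rewrite ?measure0.
have mF k : measurable (F k) := (F0 k).1.
have mN : measurable (\bigcup_k F k) by exact: bigcupT_measurable.
exists (\bigcup_k F k); split => //.
- by move=> x [k _]; rewrite /F; case: (unpickle k) => // i; case: ifP => // _ [].
- apply/(negligibleP mu mN); apply: negligible_bigcup => k.
  by apply/(negligibleP mu (mF k)); exact: (F0 k).2.
move=> x r Dx Nx r0; rewrite lt_neqAle measure_ge0 andbT eq_sym; apply/eqP => h.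
apply: Nx; have r2 : 0 < r / 2 by rewrite divr_gt0.
pose n := Num.bound (r / 2)^-1.
have nr : n.+1%:R^-1 < r / 2.
  by rewrite invf_plt ?posrE// (lt_trans (archi_boundP _)) ?ltr_nat// invr_ge0 ltW.
have n0 : (0 : R) < n.+1%:R^-1 by rewrite invr_gt0.
have [qs sqs hqs] := qdist_approx hs x n0.
exists (pickle (qs, n)) => //; rewrite /F pickleK.
have -> : mu (box (qs, n)) == 0%E.
  rewrite eq_le measure_ge0 andbT -h; apply: le_measure; rewrite ?inE//.
    by apply: measurableI => //; apply: measurable_set_lt; exact: measurable_dsum_r.
  apply: setIS => y /= hy; apply: le_lt_trans (dsum_qdist x y sqs) _.
  by rewrite [ltRHS](splitr r) (lt_trans (ltrD hqs hy))// ltrD.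
by split.
Qed.

End sum_distance.

(** Enumerating pairs of a rational and an index repeats each rational infinitely often, so
    approximations occur at arbitrarily large [k]. *)
Lemma recurrent_dense_sequence (R : realType) : exists c : nat -> R,
  forall (r e : R) n, 0 < e -> exists2 k, (n <= k)%N & `|c k - r| < e.
Proof.
exists (fun k => if (unpickle k : option (rat * nat)) is Some p then ratr p.1 else 0).
move=> r e n e0.
have [q qi] : exists q : rat, ratr q \in `]r, r + e[%R.
  by apply: rat_in_itvoo; rewrite ltrDl.
have qe : `|ratr q - r| < e.
  by move: qi; rewrite in_itv /= => /andP[q1 q2]; rewrite gtr0_norm ?subr_gt0//; lra.
suff [i hi] : exists i : nat, (n <= pickle (q, i))%N.
  by exists (pickle (q, i)) => //; rewrite pickleK.
apply: contrapT => /forallNP h.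
have hlt (i : 'I_n.+1) : (pickle (q, nat_of_ord i) < n)%N by rewrite ltnNge; apply/negP.
pose f (i : 'I_n.+1) : 'I_n := Ordinal (hlt i).
have finj : injective f.
  move=> i j /(congr1 val) /= /(pcan_inj pickleK) [] ij; exact: val_inj.
by have := leq_card f finj; rewrite !card_ord ltnn.
Qed.

Lemma measurable_nat_comp (R : realType) d (X : measurableType d) (k : X -> nat) (g : nat -> R) :
  (forall n, measurable [set x | k x = n]) -> measurable_fun setT (fun x => g (k x)).
Proof.
move=> mk _ Y mY; rewrite setTI.
have -> : (fun x => g (k x)) @^-1` Y = \bigcup_(n in [set n | Y (g n)]) [set x | k x = n].
  by apply/seteqP; split => x /=; [exists (k x)|move=> [n /= Yn ->]].
by apply: bigcup_measurable => n _; exact: mk.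
Qed.

(** * Construction of the compatible metric *)

Section metric_assembly.
Context (R : realType) d (X : measurableType d) (mu : {finite_measure set X -> \bar R}).
Hypothesis mu_nonatomic : nonatomic mu.
Hypothesis mu_neq0 : mu setT <> 0%E.
Context (phi u v : X -> R).
Hypothesis mphi : measurable_fun setT phi.
Hypothesis phi_inj : injective phi.
Hypothesis phi02 : forall x, 0 <= phi x <= 2.
Hypothesis meas_u : measurable_fun setT u.
Hypothesis meas_v : measurable_fun setT v.

Local Notation hs0 := [:: phi; u; v].

Let mhs0 : measurable_funs hs0.
Proof. by move=> [|[|[|[|i]]]] //=; exact: measurable_cst. Qed.

Let hs0E x y : dsum hs0 x y = `|phi x - phi y| + (`|u x - u y| + `|v x - v y|).
Proof. by rewrite !dsum_cons dsum_nil addr0. Qed.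

Lemma generic_base_point : exists x0, forall r : R, 0 < r ->
  (0 < mu [set y | (dsum hs0 x0 y < r)%R])%E.
Proof.
have [N [mN _ N0 hN]] := support_conull mu mhs0 (@measurableT _ X).
have [x0 Nx0] : exists x, ~ N x.
  apply: contrapT => /forallNP h; apply: mu_neq0; rewrite -N0; congr (mu _).
  by apply/seteqP; split => // x _; apply: contrapT; exact: h.
by exists x0 => r r0; have := hN x0 r Logic.I Nx0 r0; rewrite setTI.
Qed.

(* [k] is [0] on an exceptional null set, [1] off the pieces, and [n.+2] on the
   n-th piece, which lies close to [x0]. *)
Lemma cell_index x0 : (forall r : R, 0 < r -> (0 < mu [set y | (dsum hs0 x0 y < r)%R])%E) ->
  exists k : X -> nat, [/\ forall n, measurable [set x | k x = n],
    mu [set x | k x = 0%N] = 0%E,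
    forall x (r : R), k x <> 0%N -> 0 < r ->
      (0 < mu [set y | k y = k x /\ (dsum hs0 x y < r)%R])%E &
    forall n, (0 < mu [set y | k y = n.+2])%E /\
      forall y, k y = n.+2 -> dsum hs0 x0 y < n.+1%:R^-1].
Proof.
move=> hx0; pose F n := [set y | dsum hs0 x0 y < n.+1%:R^-1].
have mF n : measurable (F n) by apply: measurable_set_lt; exact: measurable_dsum_r.
have F0 n : 0 < fine (mu (F n)).
  by apply: fine_gt0; rewrite hx0 ?invr_gt0//= ltey_eq fin_num_measure.
have [D [mD DF D0 tD]] := disjoint_pieces mu_nonatomic mF F0.
(* Cell 0 is the complement of the pieces and cell [n.+1] is [D n]; together they partition the
   space. *)
pose C n := if n is n'.+1 then D n' else ~` \bigcup_i D i.
have mC n : measurable (C n).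
  by case: n => [|n]; [apply: measurableC; exact: bigcupT_measurable|exact: mD].
have coverC x : exists n, C n x.
  have [[i _ Di]|h] := pselect ((\bigcup_i D i) x); first by exists i.+1.
  by exists 0%N.
have uniqC x n m : C n x -> C m x -> n = m.
  case: n m => [|n] [|m] //= Cn Cm.
  - by exfalso; apply: Cn; exists m.
  - by exfalso; apply: Cm; exists n.
  - by congr _.+1; apply: (tD n m Logic.I Logic.I); exists x.
(* From each cell a null set is discarded, outside of which every point has non-null neighbourhoods
   within the cell. The discarded points receive index 0. *)
have supp n : exists N, [/\ measurable N, N `<=` C n, mu N = 0%E &
    forall x (r : R), C n x -> ~ N x -> 0 < r ->
      (0 < mu (C n `&` [set y | (dsum hs0 x y < r)%R]))%E].
  exact: support_conull mhs0 (mC n).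
have [N hN] := choice supp.
have mN n : measurable (N n) by have [] := hN n.
have N0 n : mu (N n) = 0%E by have [] := hN n.
have ex x : exists n, if n is n'.+1 then C n' x /\ ~ N n' x else exists m, N m x.
  have [n Cn] := coverC x.
  by have [Nn|Nn] := pselect (N n x); [exists 0%N; exists n|exists n.+1].
have [k hk] := choice ex.
have kS x n : k x = n.+1 <-> C n x /\ ~ N n x.
  split => [kx|[Cn Nn]]; first by have := hk x; rewrite kx.
  have := hk x; case: (k x) => [[m Nm]|m [Cm _]].
    have [_ NC _ _] := hN m; have mn := uniqC _ _ _ (NC _ Nm) Cn.
    by exfalso; apply: Nn; rewrite -mn.
  by rewrite (uniqC _ _ _ Cm Cn).
have goodE n : [set x | k x = n.+1] = C n `\` N n.
  by apply/seteqP; split => x /=; rewrite kS.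
have mk n : measurable [set x | k x = n].
  case: n => [|n]; last by rewrite goodE; exact: measurableD.
  have -> : [set x | k x = 0%N] = ~` \bigcup_n [set x | k x = n.+1].
    apply/seteqP; split => x /=; first by move=> k0 [n _ /=]; rewrite k0.
    move=> h; case kn: (k x) => [//|n]; exfalso; apply: h; exists n => //=.
  by apply: measurableC; apply: bigcupT_measurable => n; rewrite goodE; exact: measurableD.
have mugood n (A : set X) : measurable A -> mu (A `&` [set x | k x = n.+1]) = mu (C n `&` A).
  move=> mA; apply/eqP; rewrite eq_le; apply/andP; split.
    apply: le_measure; rewrite ?inE; [exact: measurableI|exact: measurableI|].
    by rewrite goodE => x [Ax [Cx _]].
  have -> : mu (A `&` [set x | k x = n.+1]) =
      (mu (A `&` [set x | k x = n.+1]) + mu (N n))%E by rewrite N0 adde0.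
  apply: le_trans (measureU2 mu (measurableI _ _ mA (mk _)) (mN n)).
  apply: le_measure; rewrite ?inE; [exact: measurableI| |].
    by apply: measurableU; [exact: measurableI|exact: mN].
  move=> x [Cx Ax]; have [Nx|Nx] := pselect (N n x); [by right|left; split => //].
  by rewrite goodE; split.
exists k; split => //.
- apply/(negligibleP mu (mk 0%N)).
  apply: (@negligibleS _ _ _ mu (\bigcup_n N n)).
    by move=> x /= k0; have := hk x; rewrite k0 => -[m Nm]; exists m.
  by apply: negligible_bigcup => n; apply/(negligibleP mu (mN n)); exact: N0.
- move=> x r kx r0; case kn: (k x) kx => [//|n] _.
  have [Cx Nx] := (kS x n).1 kn; have [_ _ _ /(_ x r Cx Nx r0)] := hN n.
  rewrite -mugood; last by apply: measurable_set_lt; exact: measurable_dsum_r.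
  by rewrite setIC.
move=> n; split.
  have := mugood n.+1 _ (@measurableT _ X); rewrite setTI setIT => ->.
  by rewrite -[mu _]fineK ?fin_num_measure// lte_fin; exact: D0.
by move=> y /kS[/= Dy _]; exact: (DF _ _ Dy).
Qed.

(** The metric is a truncated sum over five coordinates. Off index 0, [u'] and [v'] agree with [u]
    and [v], which gives the lower bound. For injectivity, [tau] recovers the index, [tph] separates
    points within a cell of positive index, and [psi] does so at index 0. Balls around a point of
    positive index are non-null already within its cell; the pieces accumulate at each point of
    index 0. *)
Lemma exists_compatible_metric : exists dist, compatible_metric mu dist /\
  exists N, [/\ measurable N, mu N = 0%E & forall x y, ~ N x -> ~ N y ->
    Num.min 1 (`|u x - u y| + `|v x - v y|) <= dist x y].
Proof.
have [x0 hx0] := generic_base_point.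
have [k [mk k0 kpos kfar]] := cell_index hx0.
have [c hc] := recurrent_dense_sequence R.
(* [t 0 = 0] by the convention [0^-1 = 0]: points of index [0] are at distance [1 / n]
   from those of index [n] as far as [tau] is concerned. *)
pose c' n := if n is n'.+1 then c n' else 0.
pose e n : R := (n == 0%N)%:R.
pose t n : R := n%:R^-1.
pose psi x := c' (k x) + e (k x) * phi x.
pose u' x := (1 - e (k x)) * u x + e (k x) * u x0.
pose v' x := (1 - e (k x)) * v x + e (k x) * v x0.
pose tau x := t (k x).
(* The factor [tau] shrinks the copy of [phi] in cells of large index, so that they can approach
   points of index 0. *)
pose tph x := tau x * phi x.
pose hs := [:: psi; u'; v'; tau; tph].
have mg (g : nat -> R) : measurable_fun setT (fun x => g (k x)) by exact: measurable_nat_comp.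
have mhs : measurable_funs hs.
  move=> [|[|[|[|[|i]]]]] /=.
  - by apply: measurable_funD => //; exact: measurable_funM.
  - apply: measurable_funD.
      by apply: measurable_funM => //; exact: (mg (fun n => 1 - e n)).
    by apply: measurable_funM => //; exact: measurable_cst.
  - apply: measurable_funD.
      by apply: measurable_funM => //; exact: (mg (fun n => 1 - e n)).
    by apply: measurable_funM => //; exact: measurable_cst.
  - exact: mg.
  - by apply: measurable_funM => //; exact: mg.
  - by rewrite nth_nil; exact: measurable_cst.
have hsE x y : dsum hs x y = `|psi x - psi y| + (`|u' x - u' y| + (`|v' x - v' y| +
    (`|tau x - tau y| + `|tph x - tph y|))).
  by rewrite !dsum_cons dsum_nil addr0.
have e0 x : k x = 0%N -> [/\ psi x = phi x, u' x = u x0, v' x = v x0, tau x = 0 & tph x = 0].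
  by move=> kx; rewrite /tph /psi /u' /v' /tau kx /e /t /= invr0; split; ring.
have e1 x n : k x = n.+1 -> [/\ psi x = c n, u' x = u x, v' x = v x & tau x = n.+1%:R^-1].
  by move=> kx; rewrite /psi /u' /v' /tau kx /e /t /=; split => //; ring.
have inj x y : dsum hs x y = 0 -> x = y.
  rewrite hsE => h.
  have [h1 h2 h3 h4 h5] : [/\ `|psi x - psi y| = 0, `|u' x - u' y| = 0, `|v' x - v' y| = 0,
      `|tau x - tau y| = 0 & `|tph x - tph y| = 0].
    have := normr_ge0 (psi x - psi y); have := normr_ge0 (u' x - u' y).
    have := normr_ge0 (v' x - v' y); have := normr_ge0 (tau x - tau y).
    by have := normr_ge0 (tph x - tph y); split; lra.
  have txy : tau x = tau y by apply/eqP; rewrite -subr_eq0 -normr_eq0 h4.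
  have pxy : psi x = psi y by apply/eqP; rewrite -subr_eq0 -normr_eq0 h1.
  have qxy : tph x = tph y by apply/eqP; rewrite -subr_eq0 -normr_eq0 h5.
  (* Inversion is injective even at 0, so [tau] determines the index. *)
  have kxy : k x = k y.
    by apply/eqP; rewrite -(eqr_nat R); apply/eqP/invr_inj.
  apply: phi_inj; case ky: (k y) => [|n].
    have [<- _ _ _ _] := e0 y ky; rewrite -pxy.
    by rewrite ky in kxy; have [-> _ _ _ _] := e0 x kxy.
  have [_ _ _ ty] := e1 y n ky; move: qxy; rewrite /tph txy; apply: mulfI.
  by rewrite ty invr_eq0 pnatr_eq0.
exists (fun x y => Num.min 1 (dsum hs x y)); split; last first.
  exists [set x | k x = 0%N]; split => //.
  move=> x y /= kx ky; rewrite le_min ge_min lexx /= ge_min.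
  case kxn: (k x) kx => [//|n] _; case kym: (k y) ky => [//|m] _.
  have [_ ux vx _] := e1 x n kxn; have [_ uy vy _] := e1 y m kym.
  apply/orP; right; rewrite hsE ux vx uy vy.
  have := normr_ge0 (psi x - psi y); have := normr_ge0 (tau x - tau y).
  by have := normr_ge0 (tph x - tph y); lra.
split; first exact: borel_metric_dsum.
move=> x r [y0 hy0].
have r0 : 0 < r.
  by apply: le_lt_trans hy0; rewrite le_min ler01 dsum_ge0.
have mball : measurable (dball (fun x y => Num.min 1 (dsum hs x y)) x r).
  rewrite /dball; apply: measurable_set_lt; apply: measurable_minr; first exact: measurable_cst.
  exact: measurable_dsum_r.
suff [A [mA A0 hA]] : exists A : set X, [/\ measurable A, (0 < mu A)%E &
    forall y, A y -> dsum hs x y < r].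
  apply: lt_le_trans A0 _; apply: le_measure; rewrite ?inE// => y Ay.
  by rewrite /dball /= gt_min hA// orbT.
case kx: (k x) => [|n].
  (* The budget of [r]: [r / 2] for [psi], [r / 8] for [u'] and [v'] together, [r / 8] for [tau],
     and [r / 4] for [tph] since [phi] is at most 2. *)
  have r8 : 0 < r / 8 by rewrite divr_gt0.
  pose n := Num.bound (r / 8)^-1.
  have r2 : 0 < r / 2 by rewrite divr_gt0.
  (* [psi] sends the cell of index [j.+1] to [c j]; starting from [n.+1] leaves [j] nonzero, so this
     cell is one of the pieces. *)
  have [j nj hj] := hc (phi x) (r / 2) n.+1 r2.
  case: j nj hj => // j nj hj.
  have [Apos Adist] := kfar j.
  exists [set y | k y = j.+2]; split => // y ky.
  have jr : j.+1%:R^-1 < r / 8.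
    rewrite invf_plt ?posrE// (lt_le_trans (archi_boundP _)) ?ler_nat//.
      by rewrite invr_ge0 ltW.
    by rewrite ltnW.
  have [p1 p2 p3 p4 p5] := e0 x kx; have [q1 q2 q3 q4] := e1 y j.+1 ky.
  have := Adist y ky; rewrite hs0E hsE p1 p2 p3 p4 p5 q1 q2 q3 /tph q4 !sub0r !normrN => h.
  have t0 : 0 <= j.+2%:R^-1 :> R by rewrite invr_ge0.
  have tle : j.+2%:R^-1 <= j.+1%:R^-1 :> R.
    by rewrite lef_pV2 ?posrE// ler_nat.
  have /andP[f0 f2] := phi02 y.
  rewrite (ger0_norm t0) (ger0_norm (mulr_ge0 t0 f0)).
  have tf : j.+2%:R^-1 * phi y <= j.+2%:R^-1 * 2 by rewrite ler_wpM2l.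
  rewrite distrC; have := normr_ge0 (phi x0 - phi y); move: hj h tf tle jr.
  move: (j.+2%:R^-1 : R) (j.+1%:R^-1 : R) => a b; lra.
have kx0 : k x <> 0%N by rewrite kx.
(* Within one cell [psi] and [tau] are constant and [tph] is [phi] times a factor at most 1, so the
   new distance is at most [dsum hs0]. *)
exists [set y | k y = k x /\ dsum hs0 x y < r]; split.
- have -> : [set y | k y = k x /\ dsum hs0 x y < r] =
      [set y | k y = k x] `&` [set y | dsum hs0 x y < r] by [].
  by apply: measurableI => //; apply: measurable_set_lt; exact: measurable_dsum_r.
- exact: kpos.
move=> y [ky]; rewrite hs0E hsE.
have [p1 p2 p3 p4] := e1 x n kx; rewrite kx in ky; have [q1 q2 q3 q4] := e1 y n ky.
rewrite /tph p1 p2 p3 p4 q1 q2 q3 q4 !subrr normr0 !add0r -mulrBr normrM.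
have t0 : 0 <= n.+1%:R^-1 :> R by rewrite invr_ge0.
have t1 : n.+1%:R^-1 <= 1 :> R by rewrite invf_le1// ler1n.
rewrite (ger0_norm t0) => h.
have : n.+1%:R^-1 * `|phi x - phi y| <= 1 * `|phi x - phi y| by rewrite ler_wpM2r.
by move: h; rewrite mul1r; move: (n.+1%:R^-1 * _) => a; lra.
Qed.

End metric_assembly.

(** * Sensitivity implies weak mixing *)

Lemma sqr_normc (R : realType) (w : R[i]) :
  Normc.normc w ^+ 2 = complex.Re w ^+ 2 + complex.Im w ^+ 2.
Proof. by case: w => a b /=; rewrite sqr_sqrtr// addr_ge0// sqr_ge0. Qed.

Lemma normc_ge0 (R : realType) (w : R[i]) : 0 <= Normc.normc w.
Proof. by case: w => a b; exact: sqrtr_ge0. Qed.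

Lemma normc_le_ReIm (R : realType) (w : R[i]) :
  Normc.normc w <= `|complex.Re w| + `|complex.Im w|.
Proof.
rewrite -(@ler_pXn2r _ 2) ?nnegrE ?normc_ge0 ?addr_ge0// sqr_normc.
rewrite -(real_normK (num_real (complex.Re w))) -(real_normK (num_real (complex.Im w))) sqrrD.
by rewrite lerD2r lerDl mulrn_wge0// mulr_ge0.
Qed.

Section almost_everywhere_orbits.
Context (R : realType) d (X : measurableType d) (mu : {finite_measure set X -> \bar R}).
Context (T : X -> X) (T_preserving : measure_preserving mu T).
Local Notation mu2 := (mu \x mu)%E.

Lemma measurable_iter_preserving n (A : set X) : measurable A ->
  measurable (iter n T @^-1` A) /\ mu (iter n T @^-1` A) = mu A.
Proof.
move=> mA; elim: n => [|n [mn IH]]; first by split.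
have -> : iter n.+1 T @^-1` A = T @^-1` (iter n T @^-1` A).
  by apply/funext => x; rewrite /preimage /mkset iterSr.
split; last by rewrite T_preserving.2.
by rewrite -[X in measurable X]setTI; exact: T_preserving.1.
Qed.

Lemma ae_orbit (P : X -> Prop) : {ae mu, forall x, P x} ->
  {ae mu, forall x, forall n, P (iter n T x)}.
Proof.
move=> [N [mN N0 PN]]; apply: ae_foralln => n.
have [mn en] := measurable_iter_preserving n mN.
exists (iter n T @^-1` N); split; [exact: mn|exact: etrans en N0|].
by move=> x /= nP; exact: (PN (iter n T x)).
Qed.

Lemma ae_pair (P : X -> Prop) : {ae mu, forall x, P x} ->
  {ae mu2, forall p, P p.1 /\ P p.2}.
Proof.
move=> [N [mN N0 PN]].
have m1 : measurable (N `*` [set: X]) by exact: measurableX.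
have m2 : measurable ([set: X] `*` N) by exact: measurableX.
have e1 : mu2 (N `*` [set: X]) = 0%E 
  by rewrite product_measure1E//; apply/eqP; rewrite mule_eq0; apply/orP; left; apply/eqP.
have e2 : mu2 ([set: X] `*` N) = 0%E 
  by rewrite product_measure1E//; apply/eqP; rewrite mule_eq0; apply/orP; right; apply/eqP.
apply: negligibleS (negligibleU ((negligibleP _ m1).2 e1) ((negligibleP _ m2).2 e2)).
by move=> [x y] /= /not_andP[h|h]; [left|right]; split => //=; exact: PN.
Qed.

(** The square modulus is essentially bounded and is multiplied by [|z|^2] at each step of an orbit.
    The set where it exceeds [e] thus has a null preimage under some iterate, hence is null. *)
Lemma contracting_eigenfunction_eq0 (f : X -> R[i]) (z : R[i]) : complex_Linfty mu f ->
  {ae mu, forall x, f (T x) = z * f x} -> Normc.normc z < 1 ->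
  {ae mu, forall x, f x = 0}.
Proof.
move=> [meas_u meas_v fbd] fT z1.
pose q x := complex.Re (f x) ^+ 2 + complex.Im (f x) ^+ 2.
have mq : measurable_fun setT q by apply: measurable_funD; exact: measurable_funX.
have qT x : f (T x) = z * f x -> q (T x) = Normc.normc z ^+ 2 * q x.
  by move=> fTx; rewrite /q -!sqr_normc fTx Normc.normcM exprMn.
have [M hM] : exists M : R, {ae mu, forall x, q x <= M}.
  (* The value [-oo] is not excluded here; 0 then serves as a bound. *)
  have [M bM] : exists M : R, (ess_sup mu (fun x => (Normc.normc (f x))%:E) <= M%:E)%E.
    move: fbd; case: (ess_sup _ _) => [r _|//|_]; first by exists r.
    by exists 0; exact: leNye.
  exists (M ^+ 2); move/ess_supP: bM; apply: filterS => x; rewrite lee_fin => h.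
  by rewrite /q -sqr_normc lerXn2r ?nnegrE ?normc_ge0// (le_trans _ h)// normc_ge0.
have small (e : R) : 0 < e -> {ae mu, forall x, q x <= e}.
  move=> e0; have me : measurable [set x | e < q x] by exact: measurable_set_gt.
  have z0 := normc_ge0 z.
  have rz : `|Normc.normc z ^+ 2| < 1 by rewrite ger0_norm ?sqr_ge0// expr_lt1.
  have : (Normc.normc z ^+ 2) ^+ n * `|M| @[n --> \oo] --> 0.
    by rewrite -(mul0r `|M|); apply: cvgMr_tmp; exact: cvg_expr.
  move=> /cvgr_lt/(_ _ e0)[n _ /(_ n (leqnn n)) hn].
  have [mn en] := measurable_iter_preserving n me.
  have h : {ae mu, forall x, ~ e < q (iter n T x)}.
    have := ae_orbit fT; apply: filterS2 hM => x qx fx.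
    have -> : q (iter n T x) = (Normc.normc z ^+ 2) ^+ n * q x.
      elim: (n) => [|m IH]; first by rewrite expr0 mul1r.
      by rewrite iterS (qT _ (fx m)) IH (exprS _ m) mulrA.
    apply/negP; rewrite -leNgt; apply/ltW; apply: le_lt_trans hn.
    apply: ler_wpM2l; first by rewrite exprn_ge0// sqr_ge0.
    exact: le_trans qx (ler_norm M).
  have : mu (iter n T @^-1` [set x | e < q x]) = 0%E.
    apply/(negligibleP mu mn); apply: negligibleS h => x /= ex; exact.
  rewrite en => e00; apply: filterS (measure0_ae_notin me e00) => x /= /negP.
  by rewrite -leNgt.
have := ae_foralln (fun n => small n.+1%:R^-1 (ltac:(by rewrite invr_gt0))).
apply: filterS => x hx; apply: Normc.eq0_normc.
apply/eqP; rewrite -sqrf_eq0 sqr_normc -/(q x) eq_le addr_ge0 ?sqr_ge0// andbT.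
rewrite leNgt; apply/negP => q0.
have := hx (Num.bound (q x)^-1); apply/negP; rewrite -ltNge invf_plt ?posrE//.
by rewrite (lt_trans (archi_boundP _)) ?ltr_nat// invr_ge0 ltW.
Qed.

Lemma li_yorke_weakly_mixing : standard_borel R X -> mu [set: X] <> 0%E -> nonatomic mu ->
  li_yorke_M_sensitive mu T -> weakly_mixing mu T.
Proof.
move=> sbX mu0 na LY f z fLi fT.
have [z1|z1] := ltP (Normc.normc z) 1.
  by exists 0; exact: contracting_eigenfunction_eq0 fLi fT z1.
have [A [mA sepA]] := standard_borel_separating sbX.
have [phi [mphi iphi phi02]] := injective_coding R mA sepA.
pose u x := complex.Re (f x); pose v x := complex.Im (f x).
have [meas_u meas_v _] := fLi.
have [dist [dcompat [N [mN N0 hN]]]] :=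
  exists_compatible_metric na mu0 mphi iphi phi02 meas_u meas_v.
have regular : {ae mu, forall x, ~ N x /\ f (T x) = z * f x}.
  by apply: filterS2 (measure0_ae_notin mN N0) fT => x.
have good := ae_pair (ae_orbit regular).
have eqae : {ae mu2, forall p, f p.1 = f p.2}.
  have lyd := LY dist dcompat.
  apply: filterS2 lyd good => [] [x y] /= [linf _] [gx gy].
  apply: contrapT => fxy.
  have fo w n : (forall n, ~ N (iter n T w) /\ f (T (iter n T w)) = z * f (iter n T w)) ->
      f (iter n T w) = z ^+ n * f w.
    move=> gw; elim: n => [|n IH]; first by rewrite expr0 mul1r.
    by rewrite iterS (gw n).2 IH exprS mulrA.
  pose c := Num.min 1 (Normc.normc (f x - f y)).
  have c0 : 0 < c.
    rewrite lt_min ltr01 lt_neqAle normc_ge0 andbT eq_sym; apply/eqP.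
    by move=> /Normc.eq0_normc /eqP; rewrite subr_eq0 => /eqP.
  (* Along both orbits [f] is multiplied by [z ^+ n], and [|z| >= 1], so differences of [f] do not
     shrink. *)
  have cd n : c <= dist (iter n T x) (iter n T y).
    apply: le_trans (hN _ _ (gx n).1 (gy n).1).
    rewrite le_min ge_min lexx /= ge_min; apply/orP; right.
    apply: (@le_trans _ _ (Normc.normc (f (iter n T x) - f (iter n T y)))); last first.
      by apply: le_trans (normc_le_ReIm _) _; case: (f _) => a b; case: (f _) => a' b' /=.
    rewrite (fo x n gx) (fo y n gy) -mulrBr Normc.normcM.
    rewrite ler_peMl ?normc_ge0//; elim: (n) => [|m IH]; first by rewrite expr0 Normc.normc1.
    by rewrite exprS Normc.normcM mulr_ege1.
  have : (c%:E <= 0)%E; last by rewrite lee_fin leNgt c0.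
  rewrite -linf limn_einf_lim; apply: lime_ge; first exact: is_cvg_einfs.
  apply: nearW => n; apply: le_ereal_inf_tmp => _ [m _ <-]; rewrite lee_fin; exact: cd.
have [B [mB B0 hB]] := eqae.
(* Some [x] has a null section, that is, [f x = f y] for almost every [y]. *)
have [x hx] := ae_exists mu0 (prod_measure_eq0_ae mB B0).
exists (f x); exists (xsection B x); split => //; first exact: measurable_xsection.
move=> y /= fyx; rewrite /xsection /= inE; apply: hB => /= h; exact: fyx.
Qed.

End almost_everywhere_orbits.

Local Open Scope ereal_scope.

Theorem theorem3 (R : realType) (dX : measure_display) (X : measurableType dX)
    (mu : {finite_measure set X -> \bar R}) (T : X -> X)
    (X_standard : standard_borel R X)
    (mu_nonzero : mu [set: X] <> 0)
    (mu_nonatomic : nonatomic mu)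
    (T_preserving : measure_preserving mu T)
    (T_ergodic : ergodic mu T) :
  li_yorke_M_sensitive mu T <-> weakly_mixing mu T.
Proof.
split; first exact: li_yorke_weakly_mixing.
by move=> wm dist; exact: weakly_mixing_li_yorke_ae.
Qed.
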